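(* Let $k$ be an algebraically closed field of characteristic zero and let $X$ be an affine toric surface over $k$ with acting torus $T$, whose normalization is $X_{d,e}$ and whose singular locus is the union of two irreducible curves. Fix a basis of the character lattice $M$ of $T$ such that the primitive elements generating the rays of $\sigma(X)^\vee$ are $u_1=(0,1)$ and $u_2=(d,-e)$, and let $t_1,t_2$ be the corresponding coordinates on $T$. If $e^2\equiv 1\pmod d$, put $$A=\begin{pmatrix} e & d\\ \frac{1-e^2}{d} & -e\end{pmatrix}$$ (the linear transformation of $M$ that interchanges $u_1$ and $u_2$). Then $$\operatorname{Aut}(X)\cong\begin{cases}\mathbb{Z}/2\mathbb{Z}\ltimes T, & \text{if } e^2\equiv 1\pmod d \text{ and } A \text{ preserves } S(X),\\ T, & \text{otherwise,}\end{cases}$$ where the cyclic group $\mathbb{Z}/2\mathbb{Z}=\langle\tau\rangle$ acts on the torus $T$ via $\tau(t_1,t_2)=\left(t_1^{e}\,t_2^{\frac{1-e^2}{d}},\ t_1^{d}\,t_2^{-e}\right)$.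
   Context: An affine toric variety $X$ (not necessarily normal) is $\operatorname{Spec}k[S]$ for an affine monoid $S=S(X)$, where $S(X)$ is the monoid of characters of the acting torus $T$ that are regular on $X$; $S(X)$ generates the character lattice $M$ of $T$. Here $k[S]$ has $k$-basis $\{\chi^m:m\in S\}$ with $\chi^m\chi^{m'}=\chi^{m+m'}$. With $N=\operatorname{Hom}(M,\mathbb{Z})$, set $\sigma(X)=\{u\in N_{\mathbb{Q}}:\langle m,u\rangle\ge 0\ \forall m\in S(X)\}$, and let $\sigma(X)^\vee\subset M_{\mathbb{Q}}$ be its dual cone. The normalization of $X$ is the toric surface $\operatorname{Spec}k[\sigma(X)^\vee\cap M]$. For integers $d\ge 2$, $0<e<d$ with $\gcd(d,e)=1$, $X_{d,e}$ denotes the normal affine toric surface $\operatorname{Spec}k[\{(i,j)\in\mathbb{Z}^2: i\ge 0,\ ei+dj\ge 0\}]$; equivalently $X_{d,e}=\mathbb{A}^2/G_{d,e}$, where the group $G_{d,e}$ of $d$-th roots of unity acts on $k[X,Y]$ by $\zeta\cdot F(X,Y)=F(\zeta X,\zeta^{-e}Y)$. Matrices act on column vectors in $M\cong\mathbb{Z}^2$; ''$A$ preserves $S(X)$'' means $A(S(X))=S(X)$. *)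

(* Defs.v *)
From HB Require Import structures.
From mathcomp Require Import all_boot all_order all_algebra all_fingroup.
From mathcomp Require Import finmap monalg.
From mathcomp Require Import boolp classical_sets.

Set Implicit Arguments.
Unset Strict Implicit.
Unset Printing Implicit Defensive.

Import Order.TTheory GRing.Theory Num.Theory.

Local Open Scope ring_scope.
Local Open Scope classical_set_scope.

(* The product of [{malg R[K]}] is only available over a [monomType], whose
   only invertible element is the identity; hence the separate construction
   for an arbitrary commutative monoid [S], written additively.  The
   character [chi^m] is [<< 1 *g m >>]. *)
Definition monoid_algebra (R : comNzRingType) (S : nmodType) : Type :=
  {malg R[S]}.

Section MonoidAlgebra.
Variables (R : comNzRingType) (S : nmodType).
Local Notation A := (monoid_algebra R S).

HB.instance Definition _ := GRing.Lmodule.on A.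

Definition maone : A := << 1 *g 0 >>.

Definition mamul (f g : A) : A :=
  \sum_(m <- msupp f) \sum_(n <- msupp g) << f@_m * g@_n *g m + n >>.

Lemma mamulw (d1 d2 : {fset S}) (f g : A) :
  fsubset (msupp f) d1 -> fsubset (msupp g) d2 ->
  mamul f g = \sum_(m <- d1) \sum_(n <- d2) << f@_m * g@_n *g m + n >>.
Proof.
move=> le1 le2; rewrite /mamul (big_fset_incl _ le1) /=.
  apply: eq_bigr => m _; apply: big_fset_incl => // n _ /mcoeff_outdom ->.
  by rewrite mulr0 monalgU0.
move=> m _ /mcoeff_outdom fm.
by rewrite big1 // => n _; rewrite fm mul0r monalgU0.
Qed.

Lemma mamulC : commutative mamul.
Proof.
move=> f g; rewrite /mamul exchange_big /=.
by apply: eq_bigr => m _; apply: eq_bigr => n _; rewrite mulrC addrC.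
Qed.

Lemma mamulDl : left_distributive mamul +%R.
Proof.
move=> f1 f2 g.
rewrite (mamulw (msuppD_le f1 f2) (fsubset_refl (msupp g))).
rewrite (mamulw (fsubsetUl (msupp f1) (msupp f2)) (fsubset_refl (msupp g))).
rewrite (mamulw (fsubsetUr (msupp f1) (msupp f2)) (fsubset_refl (msupp g))).
rewrite -big_split /=; apply: eq_bigr => m _.
rewrite -big_split /=; apply: eq_bigr => n _.
by rewrite mcoeffD mulrDl monalgUD.
Qed.

Lemma mamulDr : right_distributive mamul +%R.
Proof. by move=> f g h; rewrite mamulC mamulDl !(mamulC f). Qed.

Lemma mamul0l : left_zero 0 mamul.
Proof. by move=> g; rewrite /mamul msupp0 big_seq_fset0. Qed.

Lemma mamul0r : right_zero 0 mamul.
Proof. by move=> g; rewrite mamulC mamul0l. Qed.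

Lemma mamulUU c d (m n : S) :
  mamul << c *g m >> << d *g n >> = << c * d *g m + n >>.
Proof. by rewrite (mamulw msuppU_le msuppU_le) !big_seq_fset1 !mcoeffUU. Qed.

Lemma mamul1l : left_id maone mamul.
Proof.
move=> g; rewrite (mamulw msuppU_le (fsubset_refl _)) big_seq_fset1.
rewrite [RHS]monalgE; apply: eq_bigr => n _.
by rewrite mcoeffUU mul1r add0r.
Qed.

Let mamul_suml (I : Type) (r : seq I) (F : I -> A) g :
  mamul (\sum_(i <- r) F i) g = \sum_(i <- r) mamul (F i) g.
Proof. by apply: (big_morph (mamul^~ g)) => [x y|]; rewrite ?mamulDl ?mamul0l. Qed.

Let mamul_sumr (I : Type) (r : seq I) (F : I -> A) g :
  mamul g (\sum_(i <- r) F i) = \sum_(i <- r) mamul g (F i).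
Proof. by apply: (big_morph (mamul g)) => [x y|]; rewrite ?mamulDr ?mamul0r. Qed.

Lemma mamulA : associative mamul.
Proof.
move: mamul mamul_suml mamul_sumr mamulUU => op suml sumr opUU f g h.
rewrite [f]monalgE [g]monalgE !suml; apply: eq_bigr => m _.
rewrite !sumr suml; apply: eq_bigr => n _.
rewrite [h]monalgE !sumr; apply: eq_bigr => p _.
by rewrite !opUU mulrA addrA.
Qed.

Lemma maone_neq0 : maone != 0.
Proof. by rewrite monalgU_eq0 oner_eq0. Qed.

HB.instance Definition _ := GRing.Zmodule_isComNzRing.Build A
  mamulA mamulC mamul1l mamulDl maone_neq0.

Lemma mascaleE c (f : A) : c *: f = mamul << c *g 0 >> f.
Proof.
rewrite (mamulw msuppU_le (fsubset_refl _)) big_seq_fset1 malgZ_def.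
by apply: eq_bigr => n _; rewrite mcoeffUU add0r.
Qed.

Lemma mascaleAl c (f g : A) : c *: (f * g) = (c *: f) * g.
Proof. by rewrite !mascaleE -[LHS]/(mamul _ (mamul f g)) mamulA. Qed.

HB.instance Definition _ := GRing.Lmodule_isLalgebra.Build R A mascaleAl.

Lemma mascaleAr c (f g : A) : c *: (f * g) = f * (c *: g).
Proof. by rewrite mulrC mascaleAl mulrC. Qed.

HB.instance Definition _ := GRing.Lalgebra_isAlgebra.Build R A mascaleAr.

End MonoidAlgebra.

(* An affine monoid [S] in [M = Z^n], with [M] the character lattice. The
   elements of the group generated by a commutative monoid are the
   differences of elements of the monoid. *)
Record affine_monoid (n : nat) := AffineMonoid {
  am_pred :> {pred 'cV[int]_n};
  am_zero : 0 \in am_pred;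
  am_add : {in am_pred &, forall a b, a + b \in am_pred};
  am_fingen : exists gens : seq 'cV[int]_n, forall m,
    m \in am_pred <->
    exists c : 'I_(size gens) -> nat, m = \sum_(i < size gens) gens`_i *+ c i;
  am_generates : forall m, exists a b : 'cV[int]_n,
    [/\ a \in am_pred, b \in am_pred & m = a - b]
}.

HB.instance Definition _ n (S : affine_monoid n) :=
  GRing.isAddClosed.Build _ (am_pred S) (conj (am_zero S) (@am_add n S)).

Record am_elt n (S : affine_monoid n) := AmElt {
  am_val :> 'cV[int]_n; _ : am_pred S am_val }.

HB.instance Definition _ n (S : affine_monoid n) := [isSub for @am_val n S].
HB.instance Definition _ n (S : affine_monoid n) :=
  [Choice of am_elt S by <:].
HB.instance Definition _ n (S : affine_monoid n) :=
  GRing.SubChoice_isSubNmodule.Build _ (am_pred S) (am_elt S)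
    (Algebra.rpred0D (am_pred S)).

Section ToricVariety.
Variables (k : closedFieldType) (n : nat) (S : affine_monoid n).

Definition coord_ring := monoid_algebra k (am_elt S).
HB.instance Definition _ := GRing.Algebra.on coord_ring.
HB.instance Definition _ := GRing.ComNzRing.on coord_ring.

(* [X = Spec k[S]] as a classical variety: its closed points are the
   [k]-algebra homomorphisms [k[S] -> k], and [x f] is the value at [x] of
   the regular function [f]. *)
Definition cpoint : Type := {lrmorphism coord_ring -> k | *%R}.

Lemma cpoint_ext (x y : cpoint) : (forall f, x f = y f) -> x = y.
Proof.
case: x y => [x [[x0] [x1] [x2]]] [y [[y0] [y1] [y2]]] /= xy.
have {}xy : x = y by apply/funext.
subst y; congr GRing.LRMorphism.Pack.
by rewrite (Prop_irrelevance x0 y0) (Prop_irrelevance x1 y1)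
  (Prop_irrelevance x2 y2).
Qed.

Definition zariski_closed (Z : set cpoint) : Prop :=
  exists F : set coord_ring, Z = [set x | forall f, F f -> x f = 0].

Definition irreducible (Z : set cpoint) : Prop :=
  Z !=set0 /\
  forall Z1 Z2, zariski_closed Z1 -> zariski_closed Z2 ->
    Z `<=` Z1 `|` Z2 -> Z `<=` Z1 \/ Z `<=` Z2.

Definition has_chain (Z : set cpoint) (r : nat) : Prop :=
  exists c : nat -> set cpoint,
    (forall i, (i <= r)%N ->
      [/\ zariski_closed (c i), irreducible (c i) & c i `<=` Z]) /\
    (forall i, (i < r)%N -> c i `<` c i.+1).

Definition krull_dim (Z : set cpoint) (r : nat) : Prop :=
  has_chain Z r /\ ~ has_chain Z r.+1.

Definition irreducible_curve (C : set cpoint) : Prop :=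
  [/\ zariski_closed C, irreducible C & krull_dim C 1].

Definition max_ideal (x : cpoint) : set coord_ring := [set f | x f = 0].

Definition max_ideal_sq (x : cpoint) : set coord_ring :=
  [set f | exists s : seq (coord_ring * coord_ring),
    (forall p, p \in s -> max_ideal x p.1 /\ max_ideal x p.2) /\
    f = \sum_(p <- s) p.1 * p.2].

(* The [k]-vector space [m_x / m_x^2] has a basis with [r] elements. *)
Definition cotangent_dim (x : cpoint) (r : nat) : Prop :=
  exists b : 'I_r -> coord_ring,
    (forall i, max_ideal x (b i)) /\
    forall f, max_ideal x f ->
      exists! c : 'rV[k]_r, max_ideal_sq x (f - \sum_i c 0 i *: b i).

(* [X] is irreducible of dimension [n], the rank of [M], so all its local
   rings at closed points have dimension [n]. *)
Definition singular_locus : set cpoint := [set x | ~ cotangent_dim x n].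

Definition regular_map (phi : cpoint -> cpoint) : Prop :=
  forall f : coord_ring, exists g : coord_ring, forall x, phi x f = x g.

Record toric_aut := ToricAut {
  aut_fun :> cpoint -> cpoint;
  aut_inv : cpoint -> cpoint;
  aut_fun_regular : regular_map aut_fun;
  aut_inv_regular : regular_map aut_inv;
  aut_funK : cancel aut_fun aut_inv;
  aut_invK : cancel aut_inv aut_fun
}.

Lemma toric_aut_ext (phi psi : toric_aut) : phi =1 psi -> phi = psi.
Proof.
case: phi psi => [f f' fr fr' fK f'K] [g g' gr gr' gK g'K] /= fg.
have ? : f = g by apply/funext.
have ? : f' = g' by apply/funext => x; rewrite -{1}[x]g'K -fg fK.
by subst g g'; congr ToricAut; exact: Prop_irrelevance.
Qed.

HB.instance Definition _ := gen_eqMixin toric_aut.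
HB.instance Definition _ := gen_choiceMixin toric_aut.

Lemma regular_map_id : regular_map id.
Proof. by move=> f; exists f. Qed.

Lemma regular_map_comp (phi psi : cpoint -> cpoint) :
  regular_map phi -> regular_map psi -> regular_map (phi \o psi).
Proof.
move=> phir psir f; have [g fg] := phir f; have [h gh] := psir g.
by exists h => x; rewrite /= fg gh.
Qed.

Definition taut_one := ToricAut regular_map_id regular_map_id
  (fun=> erefl) (fun=> erefl).

Definition taut_mul (phi psi : toric_aut) : toric_aut :=
  ToricAut
    (regular_map_comp (aut_fun_regular phi) (aut_fun_regular psi))
    (regular_map_comp (aut_inv_regular psi) (aut_inv_regular phi))
    (can_comp (aut_funK phi) (aut_funK psi))
    (can_comp (aut_invK psi) (aut_invK phi)).

Definition taut_inv (phi : toric_aut) : toric_aut :=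
  ToricAut (aut_inv_regular phi) (aut_fun_regular phi)
    (aut_invK phi) (aut_funK phi).

Lemma taut_mulA : associative taut_mul.
Proof. by move=> f g h; apply: toric_aut_ext. Qed.
Lemma taut_mul1 : left_id taut_one taut_mul.
Proof. by move=> f; apply: toric_aut_ext. Qed.
Lemma taut_mulr1 : right_id taut_one taut_mul.
Proof. by move=> f; apply: toric_aut_ext. Qed.
Lemma taut_mulV : left_inverse taut_one taut_inv taut_mul.
Proof. by move=> f; apply: toric_aut_ext => x /=; rewrite aut_funK. Qed.
Lemma taut_mulrV : right_inverse taut_one taut_inv taut_mul.
Proof. by move=> f; apply: toric_aut_ext => x /=; rewrite aut_invK. Qed.

HB.instance Definition _ := isGroup.Build toric_aut
  taut_mulA taut_mul1 taut_mulr1 taut_mulV taut_mulrV.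

End ToricVariety.

Arguments singular_locus k {n} S _.

Section Cones.
Variable n : nat.

Definition toQ (m : 'cV[int]_n) : 'cV[rat]_n := map_mx intr m.

(* The pairing of [M_Q] with [N_Q], in dual bases. *)
Definition pairing (v u : 'cV[rat]_n) : rat := (v^T *m u) 0 0.

Definition sigma (S : affine_monoid n) : set 'cV[rat]_n :=
  [set u | forall m, m \in S -> 0 <= pairing (toQ m) u].

Definition dual_cone (C : set 'cV[rat]_n) : set 'cV[rat]_n :=
  [set v | forall u, C u -> 0 <= pairing v u].

Definition normalization_monoid (S : affine_monoid n) : set 'cV[int]_n :=
  [set m | dual_cone (sigma S) (toQ m)].

Definition preserves (A : 'M[int]_n) (S : affine_monoid n) : Prop :=
  [set A *m m | m in [set` S]] = [set` S].

Definition primitive (m : 'cV[int]_n) : Prop :=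
  m != 0 /\ forall (c : int) m', m = c *: m' -> `|c| = 1.

Definition half_line (m : 'cV[int]_n) : set 'cV[rat]_n :=
  [set v | exists2 c : rat, 0 <= c & v = c *: toQ m].

(* [m] is the primitive lattice vector of a one-dimensional face of [C]. *)
Definition ray_generator (C : set 'cV[rat]_n) (m : 'cV[int]_n) : Prop :=
  [/\ primitive m, half_line m `<=` C &
      forall x y, C x -> C y -> half_line m (x + y) ->
        half_line m x /\ half_line m y].

End Cones.

Definition vec2 (a b : int) : 'cV[int]_2 := \col_i (if i == 0 then a else b).

Definition mat2 (a b c d : int) : 'M[int]_2 :=
  \matrix_(i, j) (if i == 0 then if j == 0 then a else b
                  else if j == 0 then c else d).

(* The monoid of monomials of [X_{d,e}]. *)
Definition Xde_monoid (d e : nat) : set 'cV[int]_2 :=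
  [set m | 0 <= m 0 0 /\ 0 <= e%:Z * m 0 0 + d%:Z * m 1 0].

(* The entry [(1 - e^2) / d]; the division is exact when
   [e ^ 2 = 1 %[mod d]]. *)
Definition swap_coef (d e : nat) : int := ((1 - e%:Z ^+ 2) %/ d%:Z)%Z.

Lemma swap_coefE d e : (e ^ 2 = 1 %[mod d])%N ->
  swap_coef d e * d%:Z = 1 - e%:Z ^+ 2.
Proof.
move=> de; rewrite /swap_coef divzK // -eqz_mod_dvd.
have -> : e%:Z ^+ 2 = (e ^ 2)%N :> int by rewrite expr2 -mulnn PoszM.
by rewrite !modz_nat de.
Qed.

Definition swap_mx (d e : nat) : 'M[int]_2 :=
  mat2 e%:Z         d%:Z
       (swap_coef d e) (- e%:Z).

Lemma swap_mx_u1 d e : swap_mx d e *m vec2 0 1 = vec2 d%:Z (- e%:Z).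
Proof.
apply/matrixP=> i j; rewrite !mxE !big_ord_recl big_ord0 !mxE /=.
by case: ifP => _; rewrite mulr0 mulr1 add0r addr0.
Qed.

Lemma swap_mx_u2 d e : (e ^ 2 = 1 %[mod d])%N ->
  swap_mx d e *m vec2 d%:Z (- e%:Z) = vec2 0 1.
Proof.
move=> /swap_coefE de; apply/matrixP=> i j.
rewrite !mxE !big_ord_recl big_ord0 !mxE /=.
case: ifP => _; first by rewrite addr0 mulrN mulrC subrr.
by rewrite de mulrNN addr0 -expr2 subrK.
Qed.

Section Gm.
Variable k : fieldType.

Record Gm := MkGm { gm_val :> k; _ : gm_val != 0 }.
HB.instance Definition _ := [isSub for gm_val].
HB.instance Definition _ := [Choice of Gm by <:].

Lemma gm_neq0 (x : Gm) : (x : k) != 0. Proof. by case: x. Qed.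

Lemma gm_mul_subproof (x y : Gm) : gm_val x * gm_val y != 0.
Proof. by rewrite mulf_neq0 ?gm_neq0. Qed.
Lemma gm_inv_subproof (x : Gm) : (x : k)^-1 != 0.
Proof. by rewrite invr_neq0 ?gm_neq0. Qed.
Lemma gm_exp_subproof (x : Gm) (z : int) : (x : k) ^ z != 0.
Proof. by rewrite expfz_neq0 ?gm_neq0. Qed.

Definition gm_one := MkGm (oner_neq0 k).
Definition gm_mul x y := MkGm (gm_mul_subproof x y).
Definition gm_inv x := MkGm (gm_inv_subproof x).
Definition gm_exp x z := MkGm (gm_exp_subproof x z).

Lemma gm_mulA : associative gm_mul.
Proof. by move=> x y z; apply/val_inj/mulrA. Qed.
Lemma gm_mul1 : left_id gm_one gm_mul.
Proof. by move=> x; apply/val_inj/mul1r. Qed.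
Lemma gm_mulr1 : right_id gm_one gm_mul.
Proof. by move=> x; apply/val_inj/mulr1. Qed.
Lemma gm_mulV : left_inverse gm_one gm_inv gm_mul.
Proof. by move=> x; apply/val_inj/mulVf/gm_neq0. Qed.
Lemma gm_mulrV : right_inverse gm_one gm_inv gm_mul.
Proof. by move=> x; apply/val_inj/mulfV/gm_neq0. Qed.

HB.instance Definition _ := isGroup.Build Gm
  gm_mulA gm_mul1 gm_mulr1 gm_mulV gm_mulrV.

Definition torus2 : Type := (Gm * Gm)%type.
HB.instance Definition _ := Group.on torus2.

Definition torus_tau (d e : nat) (t : torus2) : torus2 :=
  ((gm_exp t.1 e%:Z * gm_exp t.2 (swap_coef d e))%g,
   (gm_exp t.1 d%:Z * gm_exp t.2 (- e%:Z))%g).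

Lemma torus_tauM d e : {morph torus_tau d e : s t / (s * t)%g}.
Proof.
move=> [s1 s2] [t1 t2]; congr pair; apply: val_inj;
  by rewrite /= !expfzMl mulrACA.
Qed.

Lemma torus_tauK d e : (e ^ 2 = 1 %[mod d])%N -> involutive (torus_tau d e).
Proof.
move=> /swap_coefE de [t1 t2].
have t1P := gm_neq0 t1; have t2P := gm_neq0 t2.
congr pair; apply: val_inj;
  rewrite /= !expfzMl !exprz_exp mulrACA -!expfzDr //.
  have -> : e%:Z * e%:Z + d%:Z * swap_coef d e = 1.
    by rewrite [d%:Z * _]mulrC de expr2 addrC subrK.
  by rewrite mulNr [swap_coef d e * _]mulrC subrr expr0z expr1z mulr1.
have -> : e%:Z * d%:Z + d%:Z * - e%:Z = 0 by rewrite mulrN mulrC subrr.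
by rewrite de expr0z mul1r mulrNN expr2 subrK expr1z.
Qed.

End Gm.

(* An action of [K] on [N] by group automorphisms. *)
Record group_action (K N : groupType) := GroupAction {
  gact :> K -> N -> N;
  gact1 : forall x, gact 1%g x = x;
  gactM : forall a b x, gact (a * b)%g x = gact a (gact b x);
  gact_morph : forall a, {morph gact a : x y / (x * y)%g}
}.

(* [SDProd a x] is the element [x * a] of the semidirect product, where
   [a * x * a^-1 = act a x]. *)
Record semidirect (K N : groupType) (act : group_action K N) :=
  SDProd { sd_fst : K; sd_snd : N }.

Section SemidirectProduct.
Variables (K N : groupType) (act : group_action K N).
Local Notation G := (semidirect act).

Definition sd_pair (g : G) := (sd_fst g, sd_snd g).
Lemma sd_pairK : cancel sd_pair (fun p => SDProd act p.1 p.2).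
Proof. by case. Qed.
HB.instance Definition _ := Choice.copy G (can_type sd_pairK).

Lemma gact_one a : act a 1%g = 1%g.
Proof. by apply: (@mulgI _ (act a 1%g)); rewrite -gact_morph !mulg1. Qed.

Definition sd_one : G := SDProd act 1%g 1%g.
Definition sd_mul (g h : G) : G :=
  SDProd act (sd_fst g * sd_fst h)%g (sd_snd g * act (sd_fst g) (sd_snd h))%g.
Definition sd_inv (g : G) : G :=
  SDProd act (sd_fst g)^-1%g (act (sd_fst g)^-1%g (sd_snd g)^-1%g).

Lemma sd_mulA : associative sd_mul.
Proof.
move=> [a x] [b y] [c z]; rewrite /sd_mul /=.
by rewrite gact_morph gactM !mulgA.
Qed.
Lemma sd_mul1 : left_id sd_one sd_mul.
Proof. by move=> [a x]; rewrite /sd_mul /= !mul1g gact1. Qed.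
Lemma sd_mulr1 : right_id sd_one sd_mul.
Proof. by move=> [a x]; rewrite /sd_mul /= gact_one !mulg1. Qed.
Lemma sd_mulV : left_inverse sd_one sd_inv sd_mul.
Proof.
by move=> [a x]; rewrite /sd_mul /= mulVg -gact_morph mulVg gact_one.
Qed.
Lemma sd_mulrV : right_inverse sd_one sd_inv sd_mul.
Proof.
by move=> [a x]; rewrite /sd_mul /= mulgV -gactM mulgV gact1 mulgV.
Qed.

HB.instance Definition _ := isGroup.Build G
  sd_mulA sd_mul1 sd_mulr1 sd_mulV sd_mulrV.

End SemidirectProduct.

Section InvolutionAction.
Variables (N : groupType) (tau : N -> N).
Hypotheses (tauM : {morph tau : x y / (x * y)%g}) (tauK : involutive tau).

Definition z2_act (a : 'Z_2) (x : N) : N := iter a tau x.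

Lemma z2_act1 x : z2_act 1%g x = x. Proof. by []. Qed.

Lemma z2_actM a b x : z2_act (a * b)%g x = z2_act a (z2_act b x).
Proof.
by case: a b => [[|[|a]] // a2] [[|[|b]] // b2]; rewrite /z2_act /= ?tauK.
Qed.

Lemma z2_act_morph a : {morph z2_act a : x y / (x * y)%g}.
Proof.
by case: a => [[|[|a]] // a2] x y; rewrite /z2_act /= ?tauM.
Qed.

Definition z2_action : group_action 'Z_2 N :=
  GroupAction z2_act1 z2_actM z2_act_morph.

End InvolutionAction.

Definition torus_action (k : fieldType) (d e : nat)
    (de : (e ^ 2 = 1 %[mod d])%N) : group_action 'Z_2 (torus2 k) :=
  z2_action (@torus_tauM k d e) (torus_tauK de).

Definition group_iso (G H : groupType) : Prop :=
  exists f : {multiplicative G -> H}, bijective f.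

(* Main.v *)
(* A regular automorphism of [X] preserves the singular locus.  Torus points are
   smooth, the boundary is the union of two curves, and a proper closed
   irreducible subset of such a curve is a point; so two distinct irreducible
   curves can only make up the singular locus if it is the whole boundary.  An
   automorphism therefore preserves the torus and pulls back each character to
   a regular function without zeros on the torus, that is to a monomial
   [c(m) chi^(A m)].  Here [c] is a point of the torus, and [A], an automorphism
   of [S], permutes the two ray generators of the dual cone. *)
From HB Require Import structures.
Require Import Defs.
From mathcomp Require Import all_boot all_order all_algebra all_fingroup.
From mathcomp Require Import finmap monalg.
From mathcomp Require Import ring zify.
From mathcomp Require Import boolp classical_sets.

Set Implicit Arguments.
Unset Strict Implicit.
Unset Printing Implicit Defensive.

Import Order.TTheory GRing.Theory Num.Theory.

Local Open Scope ring_scope.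
Local Open Scope classical_set_scope.

(** [S] need not be saturated, so the ray vectors themselves, or other lattice points of a face, may
    be missing from it. Two linear forms stand in for the cone: [i] and [e i + d j] are nonnegative
    on [S], each vanishes on one ray, and together they determine an element. As gradings by natural
    numbers they supply one-parameter subgroups generic enough to isolate the characters of a given
    function, and they describe the two faces that cut out the boundary. That [S] generates the
    lattice enters through pairs of elements whose differences are the standard basis: with them
    additive maps on [S] become integer matrices and multiplicative ones become torus points. The
    two cases arise because a matrix that exchanges [(0,1)] and [(d,-e)] has all its entries
    prescribed, the lower left one being [(1 - e^2)/d]; its integrality is the congruence. Up to the
    coordinate ring, the algebra is abstract and only known to have a multiplicative basis of
    characters. *)

Section ClosedFieldPoly.
Variable k : closedFieldType.

(** Once the power of ['X] is split off, the cofactor has no root at all, hence is constant. *)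
Lemma poly_nonvanishing_monomial (p : {poly k}) :
  (forall t, t != 0 -> p.[t] != 0) ->
  exists a j, a != 0 /\ p = a *: 'X^j.
Proof.
move=> pN0; have p0 : p != 0.
  by apply: contraNneq (pN0 1 (oner_neq0 _)) => ->; rewrite horner0.
have [j [q]] := multiplicity_XsubC p 0; rewrite p0 /= subr0 => q0 pE.
have [/size_poly1P[a a0 qE]|/closed_rootP[t qt]] := boolP (size q == 1%N).
  exists a, j; split=> //.
  by rewrite pE qE mul_polyC.
have t0 : t != 0 by apply: contraNneq q0 => <-.
by have := pN0 t t0; rewrite pE hornerM (rootP qt) mul0r eqxx.
Qed.

Lemma poly_vanishing (p : {poly k}) : (forall t, p.[t] = 0) -> p = 0.
Proof.
move=> pt0; have [/size1_polyC pE|sp] := leqP (size p) 1.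
  by have := pt0 0; rewrite {1}pE hornerC => p00; rewrite pE p00.
have [t] : exists t, root (p - 1) t.
  by apply/closed_rootP; rewrite size_polyDl ?size_polyN ?size_poly1 ?gtn_eqF.
by rewrite rootE hornerD hornerN hornerC pt0 sub0r oppr_eq0 oner_eq0.
Qed.

Lemma closed_field_nth_root (g : nat) (a : k) :
  (0 < g)%N -> exists t, t ^+ g = a.
Proof.
move=> g0; have [t] : exists t, root ('X^g - a%:P) t.
  by apply/closed_rootP; rewrite size_XnsubC // eqSS -lt0n.
by rewrite rootE !hornerE subr_eq0 => /eqP; exists t.
Qed.

End ClosedFieldPoly.

(* [chi_sum] and [chi_ext] say that the [chi m] form a basis of [R]. *)
Record is_monoid_algebra (k : fieldType) (R : comAlgType k) (E : nmodType)
    (chi : E -> R) : Prop := IsMonoidAlgebra {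
  chi0 : chi 0 = 1;
  chiD : forall m p, chi (m + p) = chi m * chi p;
  chi_sum : forall f, exists (s : seq E) (c : E -> k),
    [/\ uniq s, {in s, forall m, c m != 0} & f = \sum_(m <- s) c m *: chi m];
  chi_ext : forall (V : lmodType k) (w : E -> V),
    exists h : {linear R -> V}, forall m, h (chi m) = w m
}.

(* In the application, [l1] and [l2] are the primitive linear forms that vanish
   on the two rays of the dual cone. *)
Record separating_gradings (E : nmodType) (l1 l2 : E -> nat) : Prop :=
  SeparatingGradings {
  sg10 : l1 0 = 0%N;
  sg20 : l2 0 = 0%N;
  sg1D : forall m p, l1 (m + p) = (l1 m + l1 p)%N;
  sg2D : forall m p, l2 (m + p) = (l2 m + l2 p)%N;
  sg_inj : forall m p, l1 m = l1 p -> l2 m = l2 p -> m = p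
}.

Lemma separating_gradingsC (E : nmodType) (l1 l2 : E -> nat) :
  separating_gradings l1 l2 -> separating_gradings l2 l1.
Proof. by case=> l10 l20 l1D l2D linj; split=> // m p ? ?; apply: linj. Qed.

Lemma sg1Mn (E : nmodType) (l1 l2 : E -> nat) :
  separating_gradings l1 l2 -> forall m i, l1 (m *+ i) = (l1 m * i)%N.
Proof.
move=> lP m; elim=> [|i IHi]; first by rewrite mulr0n (sg10 lP) muln0.
by rewrite mulrS (sg1D lP) IHi mulnS.
Qed.

Lemma sg2Mn (E : nmodType) (l1 l2 : E -> nat) :
  separating_gradings l1 l2 -> forall m i, l2 (m *+ i) = (l2 m * i)%N.
Proof. by move=> /separating_gradingsC; apply: sg1Mn. Qed.

(** * Closed points and regular maps of the spectrum of a monoid algebra *)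

Section MonoidAlgebra.
Variables (k : closedFieldType) (R : comAlgType k) (E : nmodType).
Variable chi : E -> R.
Hypothesis spec : is_monoid_algebra chi.
Local Notation Pt := {lrmorphism R -> k | *%R}.

Let chi1 := chi0 spec.
Let chiM := chiD spec.

Lemma span_ind (P : R -> Prop) :
  P 0 -> (forall c m f, P f -> P (c *: chi m + f)) -> forall f, P f.
Proof.
move=> P0 PD f; have [s [c [_ _ ->]]] := chi_sum spec f.
by elim: s => [|m s IHs]; rewrite ?big_nil ?big_cons //; apply: PD.
Qed.

Lemma chi_inj : injective chi.
Proof.
move=> m p mp; have [h hE] := chi_ext spec (fun q => (q == m)%:R : k^o).
have := hE p; rewrite -mp hE eqxx; case: eqP => // _ /eqP.
by rewrite oner_eq0.
Qed.

(** Phrased for bare functions, so that it applies to evaluations such as [fun f => (W f).[t]] that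
    are not packed as linear maps. *)
Lemma linear_chi_eq (V : zmodType) (s : k -> V -> V) (f g : R -> V) :
    (forall c u v, f (c *: u + v) = s c (f u) + f v) ->
    (forall c u v, g (c *: u + v) = s c (g u) + g v) ->
    f 0 = g 0 -> (forall m, f (chi m) = g (chi m)) -> f =1 g.
Proof.
move=> fP gP fg0 fg; apply: span_ind => // c m h IHh.
by rewrite fP gP IHh fg.
Qed.

Lemma pt_ext (x y : Pt) : (forall m, x (chi m) = y (chi m)) -> x =1 y.
Proof.
apply: (linear_chi_eq (s := *%R)).
- by move=> c u v; rewrite linearP.
- by move=> c u v; rewrite linearP.
- by rewrite !linear0.
Qed.

Section PointExists.
Variables (v : E -> k) (v0 : v 0 = 1) (vD : forall m p, v (m + p) = v m * v p).
Variables (x : {linear R -> k^o}) (xv : forall m, x (chi m) = v m).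

(** [chi_ext] yields a map into the module [k^o]; retyped with values in [k], it can carry the
    [*%R]-linear structure required of a point. *)
Definition ptfun (f : R) : k := x f.

Lemma ptfun_linear : GRing.linear_for *%R ptfun.
Proof. by move=> c f g; rewrite /ptfun linearP. Qed.
HB.instance Definition _ := GRing.isLinear.Build k R k *%R ptfun ptfun_linear.

Lemma ptfun_monoid_morphism : monoid_morphism ptfun.
Proof.
have pE := ptfun_linear; have p0 : ptfun 0 = 0 by rewrite /ptfun linear0.
have pv : forall m, ptfun (chi m) = v m by exact: xv.
split=> [|f g]; first by rewrite -chi1 pv.
move: f; apply: span_ind => [|c m f IHf]; first by rewrite mul0r p0 mul0r.
rewrite mulrDl -scalerAl !pE IHf mulrDl -mulrA; congr (_ * _ + _).
move: g {IHf}; apply: span_ind => [|a p g IHg]; first by rewrite mulr0 p0 mulr0.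
by rewrite mulrDr -scalerAr !pE IHg -chiM !pv vD mulrDr mulrCA.
Qed.
HB.instance Definition _ :=
  GRing.isMonoidMorphism.Build R k ptfun ptfun_monoid_morphism.

Lemma ptfun_chi : exists y : Pt, forall m, y (chi m) = v m.
Proof. by exists ptfun. Qed.
End PointExists.

(** Closed points are the same as monoid morphisms from [E] to the multiplicative monoid of [k];
    points off the torus are those with a zero value. *)
Lemma pt_exists (v : E -> k) : v 0 = 1 ->
  (forall m p, v (m + p) = v m * v p) ->
  exists x : Pt, forall m, x (chi m) = v m.
Proof.
move=> v0 vD; have [x xv] := chi_ext spec (v : E -> k^o).
exact: (ptfun_chi v0 vD xv).
Qed.

Lemma pt_chi0 (x : Pt) : x (chi 0) = 1.
Proof. by rewrite chi1 rmorph1. Qed.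

Lemma pt_chiD (x : Pt) m p : x (chi (m + p)) = x (chi m) * x (chi p).
Proof. by rewrite chiM rmorphM. Qed.

Lemma pt_chiMn (x : Pt) m i : x (chi (m *+ i)) = x (chi m) ^+ i.
Proof.
elim: i => [|i IHi]; first by rewrite mulr0n pt_chi0.
by rewrite mulrS pt_chiD IHi exprS.
Qed.

Definition torus_pt (x : Pt) := forall m, x (chi m) != 0.

(** [W] is the comorphism of a parametrised curve: it turns the values of [f] along the curve into a
    polynomial in the parameter. *)
Lemma pt_horner (w : E -> {poly k}) :
  exists W : {linear R -> {poly k}}, (forall m, W (chi m) = w m) /\
    forall (x : Pt) t, (forall m, x (chi m) = (w m).[t]) ->
      forall f, x f = (W f).[t].
Proof.
have [W WE] := chi_ext spec w; exists W; split=> // x t xt.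
apply: (linear_chi_eq (s := *%R)).
- by move=> c u v; rewrite linearP.
- by move=> c u v; rewrite linearP /= hornerD hornerZ.
- by rewrite !linear0 horner0.
- by move=> m; rewrite xt WE.
Qed.

Section Gradings.
Variables l1 l2 : E -> nat.
Hypothesis lP : separating_gradings l1 l2.

(* A one-parameter subgroup that separates the exponents occurring in [f]
   turns [f] into a polynomial with the same coefficients. *)
Lemma curve_exists (f : R) : exists (p : {poly k}) (s : seq E) (c l : E -> _),
  [/\ forall t : k, exists2 x : Pt,
        (t != 0 -> torus_pt x) & x f = p.[t],
      f = \sum_(m <- s) c m *: chi m, {in s &, injective l}, uniq s &
      {in s, forall m, p`_(l m) = c m /\ c m != 0}].
Proof.
have [l10 l20 l1D l2D l_inj] := lP.
have [s [c [us cN0 fE]]] := chi_sum spec f.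
(* [N] exceeds [l1] on the support, so [l] stores [l1] as its last digit in base [N] and both
   degrees can be read off from it. *)
pose N := (\max_(m <- s) l1 m).+1; pose l m := (l1 m + N * l2 m)%N.
have [W [WE Wx]] := pt_horner (fun m => 'X^(l m)).
have linj : {in s &, injective l}.
  move=> m p ms ps lmp.
  have lt q : q \in s -> (l1 q < N)%N by move=> qs; rewrite ltnS leq_bigmax_seq.
  have l1mp : l1 m = l1 p.
    have : (l m %% N = l p %% N)%N by rewrite lmp.
    by rewrite /l ![(_ + N * _)%N]addnC !(mulnC N) !modnMDl !modn_small ?lt.
  apply: l_inj => //; move/eqP: lmp.
  by rewrite /l l1mp eqn_add2l eqn_pmul2l // => /eqP.
exists (W f), s, c, l; split=> // [t|m ms].
  have [|m p|x xE] := @pt_exists (fun m => t ^+ l m).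
  - by rewrite /l l10 l20 muln0.
  - by rewrite /l l1D l2D mulnDr addnACA exprD.
  exists x; first by move=> t0 m; rewrite xE expf_neq0.
  by apply: Wx => m; rewrite xE hornerXn.
split; last exact: cN0.
rewrite fE linear_sum coef_sum (bigD1_seq m) //= linearZ WE coefZ coefXn eqxx.
rewrite mulr1 big_seq_cond big1 ?addr0 // => p /andP[ps pm].
rewrite linearZ WE coefZ coefXn (inj_in_eq linj) // eq_sym (negPf pm).
by rewrite mulr0.
Qed.

(** On the curve of [curve_exists] the function becomes a polynomial without nonzero roots, hence a
    single power; since distinct characters of [f] give distinct powers, only one occurs. *)
Lemma nonvanishing_monomial (f : R) : (forall x, torus_pt x -> x f != 0) ->
  exists a m, a != 0 /\ f = a *: chi m.
Proof.
move=> fN0; have [p [s [c [l [px fE linj us cE]]]]] := curve_exists f.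
have [t t0|a [j [a0 pE]]] := @poly_nonvanishing_monomial _ p.
  by have [x xT <-] := px t; apply/fN0/xT.
have lj m : m \in s -> l m = j.
  move=> /cE[cm]; rewrite -cm pE coefZ coefXn.
  by have [//|_] := eqVneq (l m) j; rewrite mulr0 eqxx.
(* An empty support would make [f] vanish at the identity of the torus. *)
case: s us {px} fE linj cE lj => [_ fE _ _ _|m s us fE linj cE lj].
  have [x xE] : exists x : Pt, forall m, x (chi m) = 1.
    by apply: pt_exists => // *; rewrite mulr1.
  have : x f != 0 by apply: fN0 => m; rewrite xE oner_neq0.
  by rewrite fE big_nil linear0 eqxx.
exists (c m), m; split; first by have [] := cE m (mem_head _ _).
case: s us fE linj cE lj => [_ ->|p' s us _ linj _ lj].
  by rewrite big_seq1.
have : m = p' by apply: linj; rewrite ?inE ?eqxx ?orbT // !lj ?inE ?eqxx ?orbT.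
by move=> mp; move: us; rewrite mp /= inE eqxx.
Qed.

(** This does the work of the Nullstellensatz for a reduced algebra: the coefficients of [f] survive
    restriction to a generic curve. *)
Lemma vanishing_eq0 (f : R) : (forall x : Pt, x f = 0) -> f = 0.
Proof.
move=> f0; have [p [s [c [l [px fE linj us cE]]]]] := curve_exists f.
have p0 : p = 0 by apply: poly_vanishing => t; have [x _ <-] := px t.
rewrite fE big_seq big1 // => m /cE[]; rewrite p0 coef0 => <-.
by rewrite eqxx.
Qed.

Lemma pt_separated (f g : R) : (forall x : Pt, x f = x g) -> f = g.
Proof.
by move=> fg; apply/subr0_eq/vanishing_eq0 => x; rewrite linearB /= fg subrr.
Qed.

(** The identity of the torus, where all characters are 1, compares the coefficients. *)
Lemma monomial_eq (a b : k) m p : a != 0 ->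
  (forall x : Pt, a * x (chi m) = b * x (chi p)) -> a = b /\ m = p.
Proof.
move=> a0 mp; have [x xE] : exists x : Pt, forall m, x (chi m) = 1.
  by apply: pt_exists => // *; rewrite mulr1.
have ab : a = b by have := mp x; rewrite !xE !mulr1.
split=> //; apply/chi_inj/pt_separated => y.
by apply: (mulfI a0); rewrite mp ab.
Qed.

Definition pt_regular (phi : Pt -> Pt) :=
  forall f : R, exists g : R, forall x, phi x f = x g.

Lemma torus_regular_monomial (phi : Pt -> Pt) : pt_regular phi ->
    (forall x, torus_pt x -> torus_pt (phi x)) ->
  exists (c : E -> k) (alpha : E -> E), (forall m, c m != 0) /\
    forall x m, phi x (chi m) = c m * x (chi (alpha m)).
Proof.
move=> phir phiT.
have /choice[ca caP] : forall m, exists ca : k * E, ca.1 != 0 /\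
    forall x, phi x (chi m) = ca.1 * x (chi ca.2).
  move=> m; have [g gE] := phir (chi m).
  have [x xT|a [p [a0 gap]]] := @nonvanishing_monomial g.
    by rewrite -gE; apply: phiT.
  by exists (a, p); split=> // x; rewrite gE gap linearZ.
exists (fun m => (ca m).1), (fun m => (ca m).2).
by split=> [m|x m]; [have [] := caP m | have [_ ->] := caP m].
Qed.

Lemma torus_regular_morph (phi : Pt -> Pt) (c : E -> k) (alpha : E -> E) :
    (forall m, c m != 0) ->
    (forall x m, phi x (chi m) = c m * x (chi (alpha m))) ->
  [/\ c 0 = 1, alpha 0 = 0, forall m p, c (m + p) = c m * c p &
      forall m p, alpha (m + p) = alpha m + alpha p].
Proof.
move=> c0 phiE.
have [||c1 alpha0] := @monomial_eq (c 0) 1 (alpha 0) 0 => //.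
  by move=> x; rewrite -phiE !pt_chi0 mulr1.
have cD m p : c (m + p) = c m * c p /\ alpha (m + p) = alpha m + alpha p.
  apply: monomial_eq => // x.
  by rewrite -phiE !pt_chiD !phiE mulrACA.
by split=> // m p; have [] := cD m p.
Qed.

(** Pullback is contravariant: [psi] after [phi] on points is [alpha] after [beta] on exponents. *)
Lemma torus_regular_cancel (phi psi : Pt -> Pt) (c d : E -> k)
    (alpha beta : E -> E) :
    (forall m, c m != 0) -> (forall m, d m != 0) ->
    (forall x m, phi x (chi m) = c m * x (chi (alpha m))) ->
    (forall x m, psi x (chi m) = d m * x (chi (beta m))) ->
    (forall x, psi (phi x) =1 x) -> cancel beta alpha.
Proof.
move=> c0 d0 phiE psiE phiK m.
have [||//] := @monomial_eq (d m * c (beta m)) 1 (alpha (beta m)) m.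
  by rewrite mulf_neq0.
by move=> x; rewrite mul1r -mulrA -phiE -psiE phiK.
Qed.

(** A regular map only promises some pullback for each function; that the choice is linear and
    multiplicative follows because values at points determine functions. *)
Lemma regular_pullback (phi psi : Pt -> Pt) :
    pt_regular phi -> pt_regular psi ->
    (forall x, psi (phi x) =1 x) -> (forall x, phi (psi x) =1 x) ->
  exists sigma tau : R -> R, [/\ forall x f, phi x f = x (sigma f),
    cancel sigma tau, cancel tau sigma,
    forall f g, sigma (f * g) = sigma f * sigma g &
    forall c f g, sigma (c *: f + g) = c *: sigma f + sigma g].
Proof.
move=> /choice[sigma sE] /choice[tau tE] phiK psiK; exists sigma, tau.
split=> [x f|f|f|f g|c f g]; first exact: sE;
  apply: pt_separated => x.
- by rewrite -tE -sE psiK.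
- by rewrite -sE -tE phiK.
- by rewrite -sE !rmorphM /= !sE.
- by rewrite -sE !linearP /= !sE.
Qed.

End Gradings.
End MonoidAlgebra.

(** * Maps out of a monoid that generates the lattice *)

Section GeneratingMonoid.
Variables (n : nat) (E : nmodType) (val : E -> 'cV[int]_n) (p q : 'I_n -> E).
Hypotheses (val_inj : injective val) (val0 : val 0 = 0).
Hypothesis valD : forall m r, val (m + r) = val m + val r.
Hypothesis pqP : forall i, val (p i) - val (q i) = delta_mx i 0.

(** The expansion of [m] in the basis [p i - q i], with negative terms moved across so that it
    becomes a relation inside [E], to which maps defined only on [E] apply. *)
Lemma generating_decomposition m : exists a b : 'I_n -> nat,
  (forall i, val m i 0 = (a i)%:Z - (b i)%:Z) /\
  m + \sum_i (p i *+ b i + q i *+ a i) = \sum_i (p i *+ a i + q i *+ b i).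
Proof.
pose a i := if 0 <= val m i 0 then absz (val m i 0) else 0%N.
pose b i := if 0 <= val m i 0 then 0%N else absz (val m i 0).
have ab i : val m i 0 = (a i)%:Z - (b i)%:Z.
  rewrite /a /b; case: ifP => [/gez0_abs ->|]; first by rewrite subr0.
  by move=> /negbT; rewrite -ltNge sub0r => /ltz0_abs ->; rewrite opprK.
exists a, b; split=> //; apply: val_inj.
have val_sum (F : 'I_n -> E) : val (\sum_i F i) = \sum_i val (F i).
  exact: (big_morph val valD val0).
have valMn r i : val (r *+ i) = val r *+ i.
  by elim: i => [|i IHi]; rewrite ?mulr0n // !mulrS valD IHi.
rewrite valD !val_sum; set B := \sum_i val (p i *+ b i + q i *+ a i).
rewrite -[RHS](subrK B) -sumrB; congr (_ + _).
apply/colP => j; rewrite summxE (bigD1 j) //= big1 => [|i ij].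
  rewrite addr0 !valD !valMn ab.
  have: (val (p j) - val (q j)) j 0 = 1 by rewrite pqP mxE !eqxx.
  rewrite !mxE !mulmxnE => /(canRL (subrK _)) ->.
  move: (val (q j) j 0) (a j) (b j) => Q x y.
  by rewrite !mulrnDl !natz; move: (Q *+ x) (Q *+ y) => Qx Qy; ring.
have: (val (p i) - val (q i)) j 0 = 0 by rewrite pqP mxE eq_sym (negPf ij).
rewrite !valD !valMn !mxE !mulmxnE => /subr0_eq ->.
by rewrite [X in X - _]addrC subrr.
Qed.

(** Additivity is only asked modulo a subgroup [I]: the zero subgroup serves for matrices, the
    square of a maximal ideal for cotangent spaces. *)
Lemma generated_additive (V : zmodType) (I : V -> Prop) (F : E -> V) :
  I 0 -> (forall u w, I u -> I w -> I (u - w)) ->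
  (forall m r, I (F (m + r) - (F m + F r))) ->
  forall m, I (F m - \sum_i (F (p i) - F (q i)) *~ val m i 0).
Proof.
move=> I0 IB FD m.
have IN u : I u -> I (- u) by move=> /(IB 0 _ I0); rewrite sub0r.
have ID u w : I u -> I w -> I (u + w).
  by move=> Iu /IN/(IB _ _ Iu); rewrite opprK.
have IDD x y s t u v :
    I (x - (s + u)) -> I (s - t) -> I (u - v) -> y = t + v -> I (x - y).
  move=> Ix Is Iu ->.
  suff -> : x - (t + v) = (x - (s + u)) + ((s - t) + (u - v)).
    exact: ID _ _ Ix (ID _ _ Is Iu).
  by rewrite (addrACA s) -opprD addrA subrK.
have F0 : I (F 0).
  by have /IN := FD 0 0; rewrite addr0 opprB addrK.
have FMn r i : I (F (r *+ i) - F r *+ i).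
  elim: i => [|i IHi]; first by rewrite subr0.
  rewrite !mulrS; apply: (IDD _ _ _ _ _ _ (FD _ _) _ IHi erefl).
  by rewrite subrr.
have Fsum (G : 'I_n -> E) (G' : 'I_n -> V) :
    (forall i, I (F (G i) - G' i)) -> I (F (\sum_i G i) - \sum_i G' i).
  move=> GG'; elim/big_rec2: _ => [|i u w _ IHu]; first by rewrite subr0.
  exact: IDD _ _ _ _ _ _ (FD _ _) (GG' i) IHu erefl.
have FMn2 r s i j : I (F (r *+ i + s *+ j) - (F r *+ i + F s *+ j)).
  exact: IDD _ _ _ _ _ _ (FD _ _) (FMn r i) (FMn s j) erefl.
have [a [b [vE mE]]] := generating_decomposition m.
have IL := Fsum _ _ (fun i => FMn2 (p i) (q i) (b i) (a i)).
have IR := Fsum _ _ (fun i => FMn2 (p i) (q i) (a i) (b i)).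
have := FD m (\sum_i (p i *+ b i + q i *+ a i)).
set A := \sum_i _ in IL *; set B := \sum_i _ in IL.
rewrite mE; set C := \sum_i _ in IR *; set D := \sum_i _ in IR.
move=> ICm.
have -> : \sum_i (F (p i) - F (q i)) *~ val m i 0 = D - B.
  rewrite -sumrB; apply: eq_bigr => i _.
  rewrite vE mulrzBr !mulrzBl -!pmulrn opprB addrACA opprD.
  by rewrite [- (F (q i) *+ _) - _]addrC.
have -> : F m - (D - B) = (F C - D) - ((F C - (F m + F A)) + (F A - B)).
  rewrite (addrA (F C - _)) (opprD (F m)) (addrA (F C)) subrK.
  by rewrite !opprB addrCA [RHS]addrC -[RHS]addrA (addrA (F m - _)) subrK.
by apply: IB => //; apply: ID.
Qed.

Lemma additive_matrix r (F : E -> 'cV[int]_r) :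
    (forall m s, F (m + s) = F m + F s) ->
  exists A : 'M[int]_(r, n), forall m, F m = A *m val m.
Proof.
move=> FD; exists (\matrix_(i, j) (F (p j) - F (q j)) i 0) => m.
have /subr0_eq -> : F m - \sum_j (F (p j) - F (q j)) *~ val m j 0 = 0.
  apply: (generated_additive (I := eq^~ 0)) => // [u w -> ->|s t].
    by rewrite subrr.
  by rewrite FD subrr.
apply/colP => i; rewrite summxE !mxE.
by apply: eq_bigr => j _; rewrite -scaler_int intz !mxE mulrC.
Qed.

Lemma matrix_generating_eq r (A B : 'M[int]_(r, n)) :
  (forall m, A *m val m = B *m val m) -> A = B.
Proof.
move=> AB; apply/matrixP => i j.
have ABj : A *m delta_mx j 0 = B *m (delta_mx j 0 : 'cV_n).
  by rewrite -pqP !mulmxBr !AB.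
by have /colP/(_ i) := ABj; rewrite -!colE !mxE.
Qed.

(** [c] extends to a character of the whole lattice, that is, to the torus point with coordinates
    [c (p i) / c (q i)]. *)
Lemma multiplicative_monomial (k : fieldType) (c : E -> k) :
    (forall m, c m != 0) -> c 0 = 1 -> (forall m s, c (m + s) = c m * c s) ->
  forall m, c m = \prod_i (c (p i) / c (q i)) ^ val m i 0.
Proof.
move=> c0 c1 cD m.
have [a [b [mE]]] := generating_decomposition m.
have cMn s i : c (s *+ i) = c s ^+ i.
  by elim: i => [|i IHi]; rewrite ?mulr0n // mulrS cD IHi exprS.
move=> /(congr1 c); rewrite cD !(big_morph c cD c1) => mE'.
set B := \prod_i c (p i *+ b i + q i *+ a i) in mE'.
have B0 : B != 0 by apply/prodf_neq0 => i _; apply: c0.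
apply: (mulIf B0); rewrite mE' -big_split /=; apply: eq_bigr => i _.
rewrite !cD !cMn mE expfzDr ?mulf_neq0 ?invr_eq0 ?c0 // -exprnN.
rewrite -exprnP !expr_div_n; move: (expf_neq0 (a i) (c0 (q i))).
move: (expf_neq0 (b i) (c0 (p i))) (expf_neq0 (b i) (c0 (q i))).
move: (_ ^+ a i) (_ ^+ a i) (_ ^+ b i) (_ ^+ b i) => P Q P' Q' P'0 Q'0 Q0.
by field; rewrite P'0 Q'0 Q0.
Qed.

End GeneratingMonoid.

(** * Cotangent spaces *)

Section Cotangent.
Variables (k : closedFieldType) (R : comAlgType k).
Local Notation Pt := {lrmorphism R -> k | *%R}.

(** Convertible with [max_ideal_sq] when [R] is the coordinate ring, so results proved here transfer
    directly. *)
Definition pt_ideal_sq (x : Pt) : set R :=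
  [set f | exists s : seq (R * R),
    (forall p, p \in s -> x p.1 = 0 /\ x p.2 = 0) /\
    f = \sum_(p <- s) p.1 * p.2].

Definition pt_cotangent_dim (x : Pt) (r : nat) : Prop :=
  exists b : 'I_r -> R,
    (forall i, x (b i) = 0) /\
    forall f, x f = 0 ->
      exists! c : 'rV[k]_r, pt_ideal_sq x (f - \sum_i c 0 i *: b i).

Lemma pt_ideal_sq0 (x : Pt) : pt_ideal_sq x 0.
Proof. by exists [::]; rewrite big_nil. Qed.

Lemma pt_ideal_sqM (x : Pt) f g : x f = 0 -> x g = 0 -> pt_ideal_sq x (f * g).
Proof.
move=> xf xg; exists [:: (f, g)]; split; last by rewrite big_seq1.
by move=> p; rewrite inE => /eqP->.
Qed.

Lemma pt_ideal_sqP (x : Pt) c f g :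
  pt_ideal_sq x f -> pt_ideal_sq x g -> pt_ideal_sq x (c *: f + g).
Proof.
move=> [s [sx ->]] [t [tx ->]].
exists ([seq (c *: p.1, p.2) | p <- s] ++ t); split.
  move=> p; rewrite mem_cat => /orP[/mapP[q qs ->]|/tx//].
  by have [q1 q2] := sx q qs; rewrite linearZ /= q1 mulr0.
rewrite big_cat big_map scaler_sumr; congr (_ + _).
by apply: eq_bigr => p _; rewrite scalerAl.
Qed.

Lemma pt_ideal_sqZ (x : Pt) c f : pt_ideal_sq x f -> pt_ideal_sq x (c *: f).
Proof. by move=> /(pt_ideal_sqP c) /(_ (pt_ideal_sq0 x)); rewrite addr0. Qed.

Lemma pt_ideal_sqB (x : Pt) f g :
  pt_ideal_sq x f -> pt_ideal_sq x g -> pt_ideal_sq x (f - g).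
Proof.
by move=> xf xg; rewrite -scaleN1r addrC; apply: pt_ideal_sqP.
Qed.

(** [sigma] carries the maximal ideal of [y], and its square, onto those of [x]; a basis at [x]
    therefore comes back through [tau]. *)
Lemma pullback_cotangent_dim (x y : Pt) (sigma tau : R -> R) r :
    (forall f, y f = x (sigma f)) -> cancel sigma tau -> cancel tau sigma ->
    (forall f g, sigma (f * g) = sigma f * sigma g) ->
    (forall c f g, sigma (c *: f + g) = c *: sigma f + sigma g) ->
  pt_cotangent_dim x r -> pt_cotangent_dim y r.
Proof.
move=> yx sK tK sM sP [b [xb cb]].
have s0 : sigma 0 = 0.
  by have := sP (-1) 0 0; rewrite scaler0 addr0 scaleN1r addNr.
have sD f g : sigma (f + g) = sigma f + sigma g.
  by have := sP 1 f g; rewrite !scale1r.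
have sZ c f : sigma (c *: f) = c *: sigma f.
  by have := sP c f 0; rewrite s0 !addr0.
have sB f g : sigma (f - g) = sigma f - sigma g.
  by rewrite -!scaleN1r sD sZ.
have s_sum (I : Type) (s : seq I) (F : I -> R) :
    sigma (\sum_(i <- s) F i) = \sum_(i <- s) sigma (F i).
  exact: (big_morph sigma sD s0).
have sI f : pt_ideal_sq y f <-> pt_ideal_sq x (sigma f).
  split=> [[s [ys fE]]|[s [xs fE]]].
    exists [seq (sigma p.1, sigma p.2) | p <- s]; split.
      by move=> p /mapP[q /ys[q1 q2] ->]; rewrite -!yx q1 q2.
    by rewrite fE s_sum big_map; apply: eq_bigr => p _; rewrite sM.
  exists [seq (tau p.1, tau p.2) | p <- s]; split.
    by move=> p /mapP[q /xs[q1 q2] ->]; rewrite !yx !tK q1 q2.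
  rewrite -[f]sK fE big_map -[RHS]sK s_sum; congr tau.
  by apply: eq_bigr => p _; rewrite sM !tK.
exists (tau \o b); split=> [i|f yf]; first by rewrite yx tK.
have scb (c : 'rV_r) :
    sigma (f - \sum_i c 0 i *: tau (b i)) = sigma f - \sum_i c 0 i *: b i.
  by rewrite sB s_sum; congr (_ - _); apply: eq_bigr => i _; rewrite sZ tK.
have [|c [cI cU]] := cb (sigma f); first by rewrite -yx.
exists c; split=> [|c' c'I]; first by apply/sI; rewrite scb.
by apply: cU; rewrite -scb; apply/sI.
Qed.

End Cotangent.

Section TorusPoint.
Variables (k : closedFieldType) (R : comAlgType k) (E : nmodType).
Variable chi : E -> R.
Hypothesis spec : is_monoid_algebra chi.
Variables (n : nat) (val : E -> 'cV[int]_n) (p q : 'I_n -> E).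
Hypotheses (val_inj : injective val) (val0 : val 0 = 0).
Hypothesis valD : forall m r, val (m + r) = val m + val r.
Hypothesis pqP : forall i, val (p i) - val (q i) = delta_mx i 0.
Local Notation Pt := {lrmorphism R -> k | *%R}.

(* The logarithmic derivative [D] of [f] at [x] identifies the cotangent space
   with [M (x) k]. *)
Lemma torus_pt_cotangent_dim (x : Pt) :
  torus_pt chi x -> pt_cotangent_dim x n.
Proof.
move=> xT; pose v m := x (chi m).
have v0 : v 0 = 1 by apply: pt_chi0 spec _.
have vD m r : v (m + r) = v m * v r by apply: pt_chiD spec _ _ _.
(* The logarithmic derivative sends a character to its exponent times its value at [x]. *)
pose w m : 'rV[k]_n := v m *: (map_mx intr (val m))^T.
have [D DE] := chi_ext spec w.
have DP c f g : D (c *: f + g) = c *: D f + D g by rewrite linearP.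
have xP c f g : x (c *: f + g) = c * x f + x g by rewrite linearP.
have DM f g : D (f * g) = x f *: D g + x g *: D f.
  move: f; apply: (span_ind spec) => [|c m f IHf].
    by rewrite mul0r rmorph0 !raddf0 scale0r addr0.
  rewrite mulrDl -scalerAl !DP xP IHf scalerDr scalerA [x g * c]mulrC.
  rewrite scalerDl -!scalerA addrACA -scalerDr; congr (c *: _ + _).
  move: g {IHf}; apply: (span_ind spec) => [|a r g IHg].
    by rewrite mulr0 rmorph0 !raddf0 scale0r addr0.
  rewrite mulrDr -scalerAr !DP xP IHg scalerDr scalerA [_ * a]mulrC.
  rewrite scalerDl -!scalerA addrACA -scalerDr; congr (a *: _ + _).
  rewrite -(chiD spec) !DE /w -/(v m) -/(v r) vD valD !scalerA.
  by rewrite [v r * _]mulrC -scalerDr map_mxD linearD addrC.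
have DI f : pt_ideal_sq x f -> D f = 0.
  move=> [s [xs ->]]; rewrite linear_sum big_seq big1 // => y /xs[y1 y2].
  by rewrite DM y1 y2 !scale0r addr0.
have D1 : D 1 = 0.
  by rewrite -(chi0 spec) DE /w val0 map_mx0 trmx0 scaler0.
(* [eps] is additive modulo the squared maximal ideal, as its defect of additivity is the product
   [eps m * eps r]. *)
pose eps m := (v m)^-1 *: chi m - 1.
have xeps m : x (eps m) = 0.
  by rewrite linearB linearZ rmorph1 /= mulVf ?subrr ?xT.
have epsD m r : pt_ideal_sq x (eps (m + r) - (eps m + eps r)).
  suff -> : eps (m + r) - (eps m + eps r) = eps m * eps r.
    exact: pt_ideal_sqM.
  rewrite /eps (chiD spec) vD invfM -scalerA scalerAr scalerAl.
  by move: (_ *: chi m) (_ *: chi r) => a c; ring.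
have Deps m : D (eps m) = (map_mx intr (val m))^T.
  by rewrite linearB linearZ /= D1 subr0 DE scalerA mulVf ?scale1r ?xT.
pose b i := eps (p i) - eps (q i).
have Db i : D (b i) = delta_mx 0 i.
  rewrite linearB /= !Deps -linearB -map_mxB pqP.
  by rewrite map_delta_mx /= trmx_delta.
exists b; split=> [i|f xf]; first by rewrite linearB /= !xeps subrr.
(* First-order Taylor expansion at [x]. Being linear in [f], it reduces to characters, where it is
   the near-additivity of [eps]. *)
have fD : forall f, pt_ideal_sq x (f - x f *: 1 - \sum_i D f 0 i *: b i).
  apply: (span_ind spec) => [|c m g IHg].
    rewrite rmorph0 !raddf0 scale0r !subr0 big1 => [|i _].
      by rewrite subrr; apply: pt_ideal_sq0.
    by rewrite mxE scale0r.
  have Im : pt_ideal_sq x (chi m - v m *: 1 - \sum_i D (chi m) 0 i *: b i).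
    have -> : chi m - v m *: 1 - \sum_i D (chi m) 0 i *: b i =
      v m *: (eps m - \sum_i b i *~ val m i 0).
      rewrite DE /w scalerBr /eps scalerBr scalerA mulfV ?scale1r ?xT //.
      congr (_ - _); rewrite scaler_sumr; apply: eq_bigr => i _.
      by rewrite !mxE -scalerA scaler_int.
    apply: pt_ideal_sqZ.
    apply: (generated_additive val_inj val0 valD pqP (F := eps)) => //.
      exact: pt_ideal_sq0.
    exact: pt_ideal_sqB.
  have := pt_ideal_sqP c Im IHg; congr (pt_ideal_sq x _).
  rewrite DP xP -/(v m) !scalerBr addrACA [X in X + _]addrACA -opprD.
  rewrite -opprD scalerDl -scalerA; congr (_ - _).
  rewrite scaler_sumr -big_split /=; apply: eq_bigr => i _.
  by rewrite !mxE scalerDl scalerA.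
exists (D f); split; first by have := fD f; rewrite xf scale0r subr0.
move=> c /DI; rewrite linearB linear_sum /= => /subr0_eq ->.
apply/rowP => j; rewrite summxE (bigD1 j) //= big1 => [|i ij].
  by rewrite linearZ /= Db !mxE !eqxx mulr1 addr0.
by rewrite linearZ /= Db !mxE eqxx eq_sym (negPf ij) mulr0.
Qed.

End TorusPoint.

(** * The boundary curves *)

Section Zariski.
Variables (k : closedFieldType) (R : comAlgType k).
Local Notation Pt := {lrmorphism R -> k | *%R}.

Lemma pt_eq (x y : Pt) : x =1 y -> x = y.
Proof.
case: x y => [x [[x0] [x1] [x2]]] [y [[y0] [y1] [y2]]] /= xy.
have {}xy : x = y by apply/funext.
subst y; congr GRing.LRMorphism.Pack.
by rewrite (Prop_irrelevance x0 y0) (Prop_irrelevance x1 y1)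
  (Prop_irrelevance x2 y2).
Qed.

Definition pt_closed (Z : set Pt) : Prop :=
  exists F : set R, Z = [set x | forall f, F f -> x f = 0].

Definition pt_irreducible (Z : set Pt) : Prop :=
  Z !=set0 /\
  forall Z1 Z2, pt_closed Z1 -> pt_closed Z2 ->
    Z `<=` Z1 `|` Z2 -> Z `<=` Z1 \/ Z `<=` Z2.

Lemma pt_closed0 : pt_closed set0.
Proof.
exists [set 1]; apply/seteqP; split=> // x /(_ 1 erefl)/eqP.
by rewrite rmorph1 oner_eq0.
Qed.

Lemma pt_closedU Z1 Z2 : pt_closed Z1 -> pt_closed Z2 -> pt_closed (Z1 `|` Z2).
Proof.
move=> [F1 ->] [F2 ->].
exists [set h | exists f g, [/\ F1 f, F2 g & h = f * g]].
apply/seteqP; split=> x /=.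
  move=> [x1|x2] _ [f [g [F1f F2g ->]]]; rewrite rmorphM /=.
    by rewrite (x1 f) ?mul0r.
  by rewrite (x2 g) ?mulr0.
move=> x12; have [?|/existsNP[f /not_implyP[F1f xf]]] :=
  pselect (forall f, F1 f -> x f = 0); [by left | right=> g F2g].
have /eqP := x12 (f * g) (ex_intro _ f (ex_intro _ g (And3 F1f F2g erefl))).
by rewrite rmorphM /= mulf_eq0 => /orP[/eqP//|/eqP].
Qed.

Lemma pt_closed1 (x : Pt) : pt_closed [set x].
Proof.
exists [set f | x f = 0]; apply/seteqP; split=> [_ -> //|y /= yx].
apply: pt_eq => f; apply/subr0_eq.
have := yx (f - x f *: 1); rewrite !linearB !linearZ !rmorph1 /= mulr1.
by apply; rewrite subrr.
Qed.

(** The index type supplies the decidable equality needed to list points; in use it is the curve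
    parameter, and [s] lists the roots of a polynomial. *)
Lemma irreducible_sub_finite (I : eqType) (X : I -> Pt) (s : seq I) Z :
    (forall i, pt_closed [set X i]) -> pt_irreducible Z ->
    (forall z, Z z -> exists2 i, i \in s & z = X i) ->
  exists i, Z `<=` [set X i].
Proof.
move=> Xc [[z Zz] Zirr] Zs.
pose U (s : seq I) := [set x | exists2 i, i \in s & x = X i].
have UE i t : U (i :: t) = [set X i] `|` U t.
  apply/seteqP; split=> x /=.
    move=> [j]; rewrite inE => /orP[/eqP-> ->|jt ->]; first by left.
    by right; exists j.
  move=> [->|[j jt ->]]; first by exists i; rewrite ?mem_head.
  by exists j; rewrite // inE jt orbT.
have Uc t : pt_closed (U t).
  elim: t => [|i t IHt]; last by rewrite UE; apply: pt_closedU.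
  suff -> : U [::] = set0 by exact: pt_closed0.
  by apply/seteqP; split=> // x [].
have {}Zs : Z `<=` U s by [].
elim: s Zs => [|i t IHt] Zs; first by have [] := Zs z Zz.
rewrite UE in Zs; have [Zi|/IHt//] := Zirr _ _ (Xc i) (Uc t) Zs.
by exists i.
Qed.

End Zariski.

Section BoundaryCurve.
Variables (k : closedFieldType) (R : comAlgType k) (E : nmodType).
Variable chi : E -> R.
Hypothesis spec : is_monoid_algebra chi.
Variables l1 l2 : E -> nat.
Hypothesis lP : separating_gradings l1 l2.
Local Notation Pt := {lrmorphism R -> k | *%R}.

(** The orbit closure attached to the face [l = 0] of the monoid. *)
Definition boundary (l : E -> nat) : set Pt :=
  [set x | forall m, l m != 0%N -> x (chi m) = 0].

Lemma boundary_closed l : pt_closed (boundary l).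
Proof.
exists [set f | exists2 m, l m != 0%N & f = chi m].
apply/seteqP; split=> x xl => [_ [m lm ->]|m lm]; first exact: xl.
by apply: xl; exists m.
Qed.

Let l1Mn := sg1Mn lP.
Let l2Mn := sg2Mn lP.

(* The exponents [l2 m] of the face [l1 = 0] may only generate a subgroup
   [g Z] of [Z], hence the root extraction. *)
Lemma boundary_param (x : Pt) : boundary l1 x ->
  exists t : k, forall m, x (chi m) = if l1 m == 0%N then t ^+ l2 m else 0.
Proof.
move=> xl; have x0 : x (chi 0) = 1 by apply: pt_chi0 spec _.
have xMn m i : x (chi (m *+ i)) = x (chi m) ^+ i by apply: pt_chiMn spec _ _ _.
have xD m p : x (chi (m + p)) = x (chi m) * x (chi p).
  exact: pt_chiD spec _ _ _.
have l0 m : l1 m = 0%N -> l2 m = 0%N -> m = 0.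
  by move=> m1 m2; apply: (sg_inj lP); rewrite ?(sg10 lP) ?(sg20 lP).
(* If all nonzero characters of the face vanish at [x], the parameter is 0, with [0 ^+ 0 = 1]
   accounting for [m = 0]. *)
have [[j0 [j01 j02 xj0]]|xall] := pselect (exists j0,
    [/\ l1 j0 = 0%N, (0 < l2 j0)%N & x (chi j0) != 0]); last first.
  exists 0 => m; have [m1|m1] := eqVneq (l1 m) 0%N; last exact: xl.
  have [m2|m2] := posnP (l2 m); first by rewrite m2 expr0 (l0 m).
  rewrite expr0n gtn_eqF //; apply/eqP; apply: contra_notT xall => xm.
  by exists m.
have xN0 j : l1 j = 0%N -> x (chi j) != 0.
  move=> j1; have : x (chi j) ^+ l2 j0 != 0.
    rewrite -xMn; suff -> : j *+ l2 j0 = j0 *+ l2 j by rewrite xMn expf_neq0.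
    by apply: (sg_inj lP); rewrite ?l1Mn ?l2Mn ?j1 ?j01 // mulnC.
  by rewrite expf_eq0 j02.
(* The least positive difference of values of [l2] on the face generates the group they span, since
   division with remainder would produce a smaller one. *)
pose P g := `[< (0 < g)%N /\ exists j1 j2,
  [/\ l1 j1 = 0%N, l1 j2 = 0%N & l2 j1 = (l2 j2 + g)%N] >].
have exP : exists g, P g.
  exists (l2 j0); apply/asboolP; split=> //; exists j0, 0.
  by rewrite (sg10 lP) (sg20 lP).
case: (ex_minnP exP) => g /asboolP[g0 [j1 [j2 [j11 j21 j12]]]] gmin.
have [t tE] := closed_field_nth_root (x (chi j1) / x (chi j2)) g0.
exists t => m; have [m1|m1] := eqVneq (l1 m) 0%N; last exact: xl.
have gm : (g %| l2 m)%N.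
  rewrite /dvdn; apply: contraT; rewrite -lt0n => r0.
  have /gmin : P (l2 m %% g)%N.
    apply/asboolP; split=> //.
    exists (m + j2 *+ (l2 m %/ g)), (j1 *+ (l2 m %/ g)).
    rewrite !(sg1D lP) !(sg2D lP) !l1Mn !l2Mn m1 j11 j21 j12; split=> //.
    rewrite {1}(divn_eq (l2 m) g) mulnDl; lia.
  by rewrite leqNgt ltn_mod g0.
have mE : m + j2 *+ (l2 m %/ g) = j1 *+ (l2 m %/ g).
  apply: (sg_inj lP); rewrite ?(sg1D lP) ?(sg2D lP) ?l1Mn ?l2Mn;
    rewrite ?m1 ?j11 ?j21 ?j12 //.
  by rewrite -{1}(divnK gm) mulnDl addnC [(g * _)%N]mulnC.
have /(congr1 (fun m => x (chi m))) := mE; rewrite xD !xMn => xm.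
rewrite -(divnK gm) mulnC exprM tE expr_div_n -xm mulfK //.
by rewrite expf_neq0 // xN0.
Qed.

(** If [y] on the boundary were missing from [Z], some equation of [Z] would be a nonzero polynomial
    along the parametrised boundary. Its finitely many roots would cover [Z], and an irreducible [Z]
    would be one point, against [a <> b]. *)
Lemma boundary_curve (Z : set Pt) (a b : Pt) :
    pt_closed Z -> pt_irreducible Z -> Z a -> Z b -> a <> b ->
    Z `<=` boundary l1 -> Z = boundary l1.
Proof.
move=> [F ZE] Zirr Za Zb ab ZD; apply/seteqP; split=> // y yD.
apply: contrapT; rewrite ZE => /existsNP[f /not_implyP[Ff yf]].
have [W [WE Wx]] := pt_horner spec
  (fun m => if l1 m == 0%N then 'X^(l2 m) else 0 : {poly k}).
have Wt (x : Pt) t :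
    (forall m, x (chi m) = if l1 m == 0%N then t ^+ l2 m else 0) ->
    forall f, x f = (W f).[t].
  by move=> xE; apply: Wx => m; rewrite xE; case: ifP; rewrite !hornerE.
have p0 : W f != 0.
  have [t tE] := boundary_param yD.
  by apply: contra_not_neq yf => p0; rewrite (Wt _ _ tE) p0 horner0.
have /choice[X XE] : forall t : k, exists x : Pt, forall m,
    x (chi m) = if l1 m == 0%N then t ^+ l2 m else 0.
  move=> t; apply: (pt_exists spec) => [|m p].
    by rewrite (sg10 lP) (sg20 lP).
  rewrite (sg1D lP) (sg2D lP) addn_eq0.
  by case: (l1 m == _); case: (l1 p == _); rewrite ?mul0r ?mulr0 ?exprD.
have [s sE] := closed_field_poly_normal (W f).
have [||t tZ] := @irreducible_sub_finite _ _ _ X s Z _ Zirr.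
- by move=> i; apply: pt_closed1.
- move=> z Zz; have [t tE] := boundary_param (ZD z Zz).
  exists t; last first.
    by apply/pt_eq/(pt_ext spec) => m; rewrite tE XE.
  have : root (W f) t.
    by rewrite rootE -(Wt _ _ tE); move: Zz; rewrite ZE => /(_ f Ff) ->.
  by rewrite sE rootZ ?lead_coef_eq0 // root_prod_XsubC.
by apply: ab; rewrite (tZ a Za) (tZ b Zb).
Qed.

End BoundaryCurve.

(** * Monomial maps and the complement of the torus *)

Section MonomialMap.
Variables (k : closedFieldType) (R : comAlgType k) (E : nmodType).
Variable chi : E -> R.
Hypothesis spec : is_monoid_algebra chi.
Local Notation Pt := {lrmorphism R -> k | *%R}.

Lemma monomial_map_exists (c : E -> k) (alpha : E -> E) :
    c 0 = 1 -> (forall m p, c (m + p) = c m * c p) ->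
    alpha 0 = 0 -> (forall m p, alpha (m + p) = alpha m + alpha p) ->
  exists2 phi : Pt -> Pt, pt_regular phi &
    forall x m, phi x (chi m) = c m * x (chi (alpha m)).
Proof.
move=> c1 cD a0 aD.
have /choice[phi phiE] : forall x : Pt, exists y : Pt, forall m,
    y (chi m) = c m * x (chi (alpha m)).
  move=> x; apply: (pt_exists spec) => [|m p].
    by rewrite c1 a0 mul1r; apply: pt_chi0 spec _.
  by rewrite cD aD (pt_chiD spec) mulrACA.
exists phi => // f.
have [h hE] := chi_ext spec (fun m => c m *: chi (alpha m)).
exists (h f) => x; move: f; apply: (linear_chi_eq spec (s := *%R)).
- by move=> a u v; rewrite linearP.
- by move=> a u v; rewrite !linearP.
- by rewrite !rmorph0 raddf0 rmorph0.
- by move=> m; rewrite phiE hE linearZ.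
Qed.

Variables (l1 l2 : E -> nat) (e1 e2 : E).
Hypothesis lP : separating_gradings l1 l2.
Hypotheses (e11 : l1 e1 = 0%N) (e12 : (0 < l2 e1)%N).
Hypotheses (e21 : (0 < l1 e2)%N) (e22 : l2 e2 = 0%N).

(* The face of [E] generated by an interior element is all of [E]. *)
Lemma torus_pt_boundary (x : Pt) :
  ~ torus_pt chi x <-> (boundary chi l1 `|` boundary chi l2) x.
Proof.
split=> [xT|[xl|xl] xT]; last first.
- by have := xT e1; rewrite xl ?eqxx // -lt0n.
- by have := xT e2; rewrite xl ?eqxx // -lt0n.
apply: contrapT => /not_orP[].
move=> /existsNP[m1 /not_implyP[l1m1 /eqP xm1]].
move=> /existsNP[m2 /not_implyP[l2m2 /eqP xm2]].
apply: xT => m; apply/eqP => xm; pose w := m1 + m2.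
have xw : x (chi w) != 0 by rewrite /w (pt_chiD spec) mulf_neq0.
have w1 : (0 < l1 w)%N by rewrite /w (sg1D lP) addn_gt0 lt0n l1m1.
have w2 : (0 < l2 w)%N by rewrite /w (sg2D lP) addn_gt0 !lt0n l2m2 orbT.
(* [N] is large enough for [w *+ N] to dominate [m] in both degrees; the factor [K] makes the two
   deficits multiples of [l1 e2] and [l2 e1], so that [e2] and [e1] can fill them. *)
clearbody w; pose N := (l1 m + l2 m)%N; pose K := (l1 e2 * l2 e1)%N.
have K0 : (0 < K)%N by rewrite muln_gt0 e21.
have l1Mn := sg1Mn lP; have l2Mn := sg2Mn lP.
have wE : m *+ K + (e1 *+ (l1 e2 * (l2 w * N - l2 m))
     + e2 *+ (l2 e1 * (l1 w * N - l1 m))) = w *+ (N * K).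
  have le1 : (l1 m <= l1 w * N)%N.
    by rewrite (leq_trans (leq_addr (l2 m) _)) // leq_pmull.
  have le2 : (l2 m <= l2 w * N)%N.
    by rewrite (leq_trans (leq_addl (l1 m) _)) // leq_pmull.
  apply: (sg_inj lP).
    rewrite !(sg1D lP) !l1Mn e11 mul0n add0n.
    rewrite [RHS]mulnA -[in RHS](subnKC le1) [RHS]mulnDl.
    by rewrite /K; congr (_ + _)%N; rewrite mulnA mulnC.
  rewrite !(sg2D lP) !l2Mn e22 mul0n addn0.
  rewrite [RHS]mulnA -[in RHS](subnKC le2) [RHS]mulnDl.
  by rewrite /K; congr (_ + _)%N; rewrite mulnA mulnC [(l2 e1 * _)%N]mulnC.
have := expf_neq0 (N * K) xw.
rewrite -(pt_chiMn spec) -wE (pt_chiD spec) (pt_chiMn spec) xm.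
by rewrite expr0n gtn_eqF // mul0r eqxx.
Qed.

End MonomialMap.

(** * The coordinate ring and its automorphisms *)

Section CoordinateRing.
Variables (k : closedFieldType) (n : nat) (S : affine_monoid n).
Local Notation R := (coord_ring k S).
Local Notation E := (am_elt S).

Definition char (m : E) : R := << 1 *g m >>.

Lemma charD (m p : E) : char (m + p) = char m * char p.
Proof. by rewrite -[RHS]/(mamul _ _) mamulUU mulr1. Qed.

Lemma coord_coefZ c (f : R) p : (c *: f)@_p = c * f@_p.
Proof. exact: mcoeffZ. Qed.

Lemma coord_coefD (f g : R) p : (f + g)@_p = f@_p + g@_p.
Proof. exact: mcoeffD. Qed.

Lemma coord_coefU c (m p : E) : (<< c *g m >> : R)@_p = c *+ (m == p).
Proof. exact: mcoeffU. Qed.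

Lemma coord_coef_char (m p : E) : (char m)@_p = (m == p)%:R.
Proof. exact: coord_coefU. Qed.

Lemma charZ c (m : E) : << c *g m >> = c *: char m.
Proof.
by apply/malgP => p; rewrite coord_coefU coord_coefZ coord_coef_char mulr_natr.
Qed.

Lemma char_sum (f : R) : f = \sum_(m <- msupp f) f@_m *: char m.
Proof. by rewrite {1}[f]monalgE; apply: eq_bigr => m _; rewrite charZ. Qed.

Section LinearExtension.
Variables (V : lmodType k) (w : E -> V).

Definition lext (f : R) : V := \sum_(m <- msupp f) f@_m *: w m.

Lemma lextw (D : {fset E}) (f : R) : fsubset (msupp f) D ->
  lext f = \sum_(m <- D) f@_m *: w m.
Proof.
move=> le; rewrite [LHS](big_fset_incl _ le) => //= x xd /mcoeff_outdom ->.
by rewrite scale0r.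
Qed.

Lemma lext_linear : linear lext.
Proof.
move=> c f g; set D := (msupp (c *: f + g) `|` msupp f `|` msupp g)%fset.
have leD : fsubset (msupp (c *: f + g)) D by rewrite /D -fsetUA fsubsetUl.
have lef : fsubset (msupp f) D.
  by rewrite /D [(_ `|` msupp f)%fset]fsetUC -fsetUA fsubsetUl.
have leg : fsubset (msupp g) D by rewrite fsubsetUr.
rewrite (lextw leD) (lextw lef) (lextw leg) scaler_sumr -big_split /=.
by apply: eq_bigr => m _; rewrite scalerA -scalerDl coord_coefD coord_coefZ.
Qed.
HB.instance Definition _ := GRing.isLinear.Build k R V *:%R lext lext_linear.

Lemma lext_char m : lext (char m) = w m.
Proof.
by rewrite (lextw msuppU_le) big_seq_fset1 coord_coef_char eqxx scale1r.
Qed.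

Lemma lext_exists : exists h : {linear R -> V}, forall m, h (char m) = w m.
Proof. by exists lext; apply: lext_char. Qed.

End LinearExtension.

Lemma coord_ring_spec : @is_monoid_algebra k R E char.
Proof.
split; [by [] | exact: charD | | exact: lext_exists].
move=> f; exists (msupp f), (fun m => f@_m).
split; [exact: fset_uniq | | exact: char_sum].
by move=> m; rewrite -mcoeff_neq0.
Qed.

End CoordinateRing.

Section AffineMonoid.
Variables (n : nat) (S : affine_monoid n).

Lemma am_val0 : am_val (0 : am_elt S) = 0.
Proof. exact: raddf0. Qed.

Lemma am_valD (m p : am_elt S) : am_val (m + p) = am_val m + am_val p.
Proof. exact: Algebra.valD. Qed.

Lemma am_val_inj : injective (@am_val n S).
Proof. exact: val_inj. Qed.

Lemma am_elt_mem (m : am_elt S) : am_val m \in S.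
Proof. exact: valP m. Qed.

Lemma am_eltP (m : 'cV[int]_n) : m \in S -> exists m' : am_elt S, am_val m' = m.
Proof. by move=> mS; exists (AmElt mS). Qed.

Lemma am_basis : exists p q : 'I_n -> am_elt S,
  forall i, am_val (p i) - am_val (q i) = delta_mx i 0.
Proof.
have /choice[pq pqE] : forall i : 'I_n, exists pq : am_elt S * am_elt S,
    am_val pq.1 - am_val pq.2 = delta_mx i 0.
  move=> i; have [a [b [/am_eltP[p <-] /am_eltP[q <-] ->]]] :=
    am_generates S (delta_mx i 0).
  by exists (p, q).
by exists (fun i => (pq i).1), (fun i => (pq i).2).
Qed.

Lemma am_matrix (F : am_elt S -> am_elt S) :
    (forall m s, F (m + s) = F m + F s) ->
  exists A : 'M[int]_n, forall m, am_val (F m) = A *m am_val m.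
Proof.
move=> FD; have [p [q pqE]] := am_basis.
apply: (additive_matrix am_val_inj am_val0 am_valD pqE (F := @am_val n S \o F)).
by move=> m s; rewrite /comp FD am_valD.
Qed.

Lemma am_matrix_eq (A B : 'M[int]_n) :
  (forall m : am_elt S, A *m am_val m = B *m am_val m) -> A = B.
Proof.
have [p [q pqE]] := am_basis.
exact: (matrix_generating_eq pqE).
Qed.

End AffineMonoid.

Section Automorphisms.
Variables (k : closedFieldType) (n : nat) (S : affine_monoid n).
Local Notation E := (am_elt S).
Local Notation chi := (@char k n S).
Variables l1 l2 : E -> nat.
Hypothesis lP : separating_gradings l1 l2.

Lemma aut_nonsingular (phi : toric_aut k S) x :
  ~ singular_locus k S x -> ~ singular_locus k S (phi x).
Proof.
have [sigma [tau [phiE sK tK sM sP]]] :=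
  regular_pullback (@coord_ring_spec k n S) lP
    (aut_fun_regular phi) (aut_inv_regular phi)
    (fun y f => congr1 (fun z : cpoint k S => z f) (aut_funK phi y))
    (fun y f => congr1 (fun z : cpoint k S => z f) (aut_invK phi y)).
move=> /contrapT xns; apply.
exact: (pullback_cotangent_dim (phiE x) sK tK sM sP xns).
Qed.

Hypothesis sing :
  forall x : cpoint k S, singular_locus k S x <-> ~ torus_pt chi x.

Lemma aut_torus_pt (phi : toric_aut k S) x :
  torus_pt chi x -> torus_pt chi (phi x).
Proof.
move=> xT; apply: contrapT => /sing; apply: aut_nonsingular.
by move=> /sing; apply.
Qed.

Lemma aut_monomial (phi : toric_aut k S) :
  exists (c : E -> k) (alpha beta : E -> E),
    [/\ forall m, c m != 0,
        c 0 = 1 /\ (forall m p, c (m + p) = c m * c p),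
        (forall m p, alpha (m + p) = alpha m + alpha p) /\
        (forall m p, beta (m + p) = beta m + beta p),
        cancel alpha beta /\ cancel beta alpha &
        forall x m, phi x (chi m) = c m * x (chi (alpha m))].
Proof.
have spec := @coord_ring_spec k n S.
have [c [alpha [c0 phiE]]] :=
  torus_regular_monomial spec lP (aut_fun_regular phi) (aut_torus_pt phi).
have [d [beta [d0 psiE]]] :=
  torus_regular_monomial spec lP (aut_inv_regular phi) (aut_torus_pt phi^-1%g).
have [c1 _ cD aD] := torus_regular_morph spec lP c0 phiE.
have [_ _ _ bD] := torus_regular_morph spec lP d0 psiE.
exists c, alpha, beta.
split; [exact: c0 | by split | by split | split | exact: phiE].
  apply: (torus_regular_cancel spec lP d0 c0 psiE phiE) => x f.
  exact: (congr1 (fun z : cpoint k S => z f) (aut_invK phi x)).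
apply: (torus_regular_cancel spec lP c0 d0 phiE psiE) => x f.
exact: (congr1 (fun z : cpoint k S => z f) (aut_funK phi x)).
Qed.

(** Reduces an isomorphism to data on exponents. [alpha] reverses products because it acts on
    characters while automorphisms act on points; [c] then obeys the matching cocycle rule. *)
Lemma aut_group_iso (H : groupType) (c : H -> E -> k) (alpha : H -> E -> E) :
    (forall g m, c g m != 0) ->
    (forall g, c g 0 = 1) -> (forall g m p, c g (m + p) = c g m * c g p) ->
    (forall g, alpha g 0 = 0) ->
    (forall g m p, alpha g (m + p) = alpha g m + alpha g p) ->
    (forall m, c 1%g m = 1) -> (forall m, alpha 1%g m = m) ->
    (forall g h m, c (g * h)%g m = c g m * c h (alpha g m)) ->
    (forall g h m, alpha (g * h)%g m = alpha h (alpha g m)) ->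
    (forall g h, c g =1 c h -> alpha g =1 alpha h -> g = h) ->
    (forall phi : toric_aut k S, exists g, forall x m,
       phi x (chi m) = c g m * x (chi (alpha g m))) ->
  group_iso (toric_aut k S) H.
Proof.
move=> cN0 c0 cD a0 aD c1 a1 cM aM inj surj.
have spec := @coord_ring_spec k n S.
have /choice[P PE] : forall g, exists P : cpoint k S -> cpoint k S,
    regular_map P /\ forall x m, P x (chi m) = c g m * x (chi (alpha g m)).
  move=> g; have [P Preg PE] :=
    monomial_map_exists spec (c0 g) (cD g) (a0 g) (aD g).
  by exists P.
have Preg g : regular_map (P g) by have [] := PE g.
have {}PE g x m : P g x (chi m) = c g m * x (chi (alpha g m)).
  by have [_] := PE g.
have pt_chi_eq (x y : cpoint k S) : (forall m, x (chi m) = y (chi m)) -> x = y.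
  by move=> xy; apply/cpoint_ext/(pt_ext spec).
have PM g h x : P g (P h x) = P (g * h)%g x.
  by apply: pt_chi_eq => m; rewrite !PE cM aM mulrA.
have P1 x : P 1%g x = x.
  by apply: pt_chi_eq => m; rewrite PE c1 a1 mul1r.
have PK g : cancel (P g) (P g^-1%g) by move=> x; rewrite PM mulVg P1.
have PVK g : cancel (P g^-1%g) (P g) by move=> x; rewrite PM mulgV P1.
pose Q g := ToricAut (Preg g) (Preg g^-1%g) (PK g) (PVK g).
have /choice[F FE] : forall phi : toric_aut k S, exists g, Q g = phi.
  move=> phi; have [g gE] := surj phi; exists g.
  by apply: toric_aut_ext => x; apply: pt_chi_eq => m; rewrite PE gE.
have Qinj g h : Q g = Q h -> g = h.
  move=> QE; have gh m : c g m = c h m /\ alpha g m = alpha h m.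
    apply: (monomial_eq spec lP (cN0 g m)) => x.
    by rewrite -!PE (congr1 (fun phi : toric_aut k S => phi x (chi m)) QE).
  by apply: inj => m; have [] := gh m.
have QF g : F (Q g) = g by apply/Qinj/FE.
have FM : {morph F : x y / (x * y)%g}.
  move=> phi psi; apply: Qinj; rewrite FE; apply: toric_aut_ext => x.
  by rewrite -[in LHS](FE phi) -[in LHS](FE psi); apply: PM.
pose Fm : {multiplicative toric_aut k S -> H} :=
  HB.pack F (monoid.isMultiplicative.Build _ _ F FM).
by exists Fm; exists Q.
Qed.

End Automorphisms.

(** * Cones and rays in the plane *)

Section RayGenerators.
Variables (n : nat) (S : affine_monoid n).
Local Notation C := (dual_cone (sigma S)).
Local Notation matQ A := (map_mx intr A : 'M[rat]_n).

Lemma toQ_mul (A : 'M[int]_n) m : toQ (A *m m) = matQ A *m toQ m.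
Proof. exact: map_mxM. Qed.

(** By adjunction for the pairing, the transpose of [A] preserves [sigma S]. *)
Lemma cone_stable (A : 'M[int]_n) v :
  (forall m, m \in S -> A *m m \in S) -> C v -> C (matQ A *m v).
Proof.
move=> AS Cv u su; rewrite /pairing trmx_mul -mulmxA.
apply: Cv => m mS; rewrite /pairing mulmxA -trmx_mul -toQ_mul.
exact/su/AS.
Qed.

(** The inverse [B] takes a factorization of [A *m m], or a sum in the cone lying on its half-line,
    back to one for [m]. *)
Lemma ray_generator_stable (A B : 'M[int]_n) m :
    A *m B = 1%:M -> B *m A = 1%:M ->
    (forall m, m \in S -> A *m m \in S) ->
    (forall m, m \in S -> B *m m \in S) ->
  ray_generator C m -> ray_generator C (A *m m).
Proof.
move=> AB BA AS BS [[m0 mprim] mC mext].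
have ABQ v : matQ A *m (matQ B *m v) = v.
  by rewrite mulmxA -map_mxM AB map_mx1 mul1mx.
have BAQ v : matQ B *m (matQ A *m v) = v.
  by rewrite mulmxA -map_mxM BA map_mx1 mul1mx.
have hlA v : half_line (A *m m) v <-> half_line m (matQ B *m v).
  split=> [[c c0 ->]|[c c0 vE]]; exists c => //.
    by rewrite toQ_mul -scalemxAr BAQ.
  by rewrite toQ_mul scalemxAr -vE ABQ.
split.
- split=> [|c m' mE].
    by apply: contraNneq m0 => Am0; rewrite -[m]mul1mx -BA -mulmxA Am0 mulmx0.
  apply: (mprim c (B *m m')).
  by rewrite scalemxAr -mE mulmxA BA mul1mx.
- move=> v /hlA vm; rewrite -[v]ABQ; apply: cone_stable => //.
  exact: mC.
- move=> x y Cx Cy /hlA xy.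
  have [|||xm ym] := mext (matQ B *m x) (matQ B *m y).
  + exact: cone_stable.
  + exact: cone_stable.
  + by rewrite -mulmxDr.
  + by split; apply/hlA.
Qed.

End RayGenerators.

Section Plane.

Definition form2 (a b : int) (m : 'cV[int]_2) : int := a * m 0 0 + b * m 1 0.

Lemma form2D a b m p : form2 a b (m + p) = form2 a b m + form2 a b p.
Proof. by rewrite /form2 !mxE; ring. Qed.

Lemma form2_0 a b : form2 a b 0 = 0.
Proof. by rewrite /form2 !mxE !mulr0. Qed.

Lemma col2P (v w : 'cV[int]_2) : v 0 0 = w 0 0 -> v 1 0 = w 1 0 -> v = w.
Proof.
move=> v0 v1; apply/colP => i.
have [-> //|i0] := eqVneq i 0; suff -> : i = 1 by [].
by apply/val_inj; case: i i0 => [[|[|i]] i2].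
Qed.

Lemma mulmx2E (A : 'M[int]_2) (v : 'cV[int]_2) i :
  (A *m v) i 0 = A i 0 * v 0 0 + A i 1 * v 1 0.
Proof.
rewrite mxE !big_ord_recl big_ord0 addr0.
by rewrite (_ : lift ord0 ord0 = 1) //; apply/val_inj.
Qed.

Lemma pairing_form2 a b m :
  pairing (toQ m) (toQ (vec2 a b)) = (form2 a b m)%:~R.
Proof.
rewrite /pairing /form2 mxE !big_ord_recl big_ord0 addr0.
rewrite (_ : lift ord0 ord0 = 1); last exact/val_inj.
by rewrite !mxE /= rmorphD !rmorphM /= mulrC [(b%:~R * _)]mulrC.
Qed.

Variable S : affine_monoid 2.

(* If [S] met the ray [form2 a b = 0] only in the origin, then
   [N * form2 a b - form2 a' b'] would belong to [sigma S] for large [N],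
   although it is negative at [w]. *)
Lemma face_elt a b a' b' w :
    (forall m, m \in S -> 0 <= form2 a b m) ->
    normalization_monoid S w -> form2 a b w = 0 -> 0 < form2 a' b' w ->
  exists m : am_elt S, form2 a b (am_val m) = 0 /\ 0 < form2 a' b' (am_val m).
Proof.
move=> abS wS w0 w'; apply: contrapT => noface.
have ab0 m : m \in S -> form2 a b m = 0 -> form2 a' b' m <= 0.
  move=> /am_eltP[m' <-] m0; rewrite leNgt; apply/negP => m'0.
  by apply: noface; exists m'.
have [gens gensP] := am_fingen S.
(* On a generator off the face [form2 a b] is at least 1, so [N] times it outweighs [form2 a' b'];
   on the face the latter is not positive. *)
pose N : int := \sum_(g <- gens) `|form2 a' b' g|.
have formE m :
    form2 (N * a - a') (N * b - b') m = N * form2 a b m - form2 a' b' m.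
  by rewrite /form2; ring.
have gensS i : (i < size gens)%N -> gens`_i \in S.
  move=> igens; apply/gensP; exists (fun j => (j == Ordinal igens : nat)).
  rewrite (bigD1 (Ordinal igens)) //= big1 ?addr0 ?eqxx // => j /negPf->.
  by rewrite mulr0n.
have gens_ge0 i : (i < size gens)%N ->
    0 <= form2 (N * a - a') (N * b - b') gens`_i.
  move=> igens; rewrite formE subr_ge0; have gS := gensS i igens.
  have [g0|g0] := eqVneq (form2 a b gens`_i) 0.
    by rewrite g0 mulr0 ab0.
  have g1 : 1 <= form2 a b gens`_i by rewrite -gtz0_ge1 lt_def g0 abS.
  have gN : `|form2 a' b' gens`_i| <= N.
    rewrite /N (big_nth 0) big_mkord (bigD1 (Ordinal igens)) //= lerDl.
    exact: sumr_ge0.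
  apply: le_trans (ler_norm _) (le_trans gN _).
  by rewrite ler_peMr // (le_trans _ gN).
have : (0 : rat) <= pairing (toQ w) (toQ (vec2 (N * a - a') (N * b - b'))).
  apply: wS => m /gensP[c ->]; rewrite pairing_form2 ler0z.
  elim/big_ind: _ => [|x y x0 y0|i _]; first by rewrite form2_0.
    by rewrite form2D addr_ge0.
  elim: (c i) => [|j IHj]; first by rewrite mulr0n form2_0.
  by rewrite mulrS form2D addr_ge0 // gens_ge0.
by rewrite pairing_form2 ler0z formE w0 mulr0 sub0r oppr_ge0 leNgt w'.
Qed.

End Plane.

(** * The singular locus as the whole boundary *)

Section SingularLocus.
Variables (k : closedFieldType) (n : nat) (S : affine_monoid n).
Local Notation E := (am_elt S).
Local Notation chi := (@char k n S).

(** A chain of length one in [Z] exhibits the two distinct points that [boundary_curve] asks for. *)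
Lemma irreducible_curve_boundary (l1 l2 : E -> nat) (Z : set (cpoint k S)) :
    separating_gradings l1 l2 -> irreducible_curve Z ->
    Z `<=` boundary chi l1 -> Z = boundary chi l1.
Proof.
move=> lP [Zc Zirr [[c [cP clt]] _]].
have [_ [[a c0a] _] c0Z] := cP 0%N isT.
have [_ _ c1Z] := cP 1%N isT.
have [_ /existsNP[b /not_implyP[c1b c0b]]] := clt 0%N isT.
apply: (@boundary_curve _ _ _ _ (@coord_ring_spec k n S) _ _ lP Z a b Zc Zirr).
- exact: c0Z.
- exact: c1Z.
- by move=> ab; apply: c0b; rewrite -ab.
Qed.

Lemma singular_locus_torus (l1 l2 : E -> nat) (e1 e2 : E) :
    separating_gradings l1 l2 ->
    l1 e1 = 0%N -> (0 < l2 e1)%N -> (0 < l1 e2)%N -> l2 e2 = 0%N ->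
    (exists C1 C2 : set (cpoint k S),
      [/\ irreducible_curve C1, irreducible_curve C2, C1 <> C2 &
          singular_locus k S = C1 `|` C2]) ->
  forall x : cpoint k S, singular_locus k S x <-> ~ torus_pt chi x.
Proof.
move=> lP e11 e12 e21 e22 [C1 [C2 [C1c C2c C12 singE]]].
have spec := @coord_ring_spec k n S.
have torusE := torus_pt_boundary spec lP e11 e12 e21 e22.
have [p [q pqE]] := am_basis S.
have sing_sub x :
    singular_locus k S x -> (boundary chi l1 `|` boundary chi l2) x.
  move=> xs; apply/torusE => xT; apply: xs.
  exact: (torus_pt_cotangent_dim spec (@am_val_inj _ S) (am_val0 S)
    (@am_valD _ S) pqE xT).
have curve C : irreducible_curve C -> C `<=` singular_locus k S ->
    C = boundary chi l1 \/ C = boundary chi l2.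
  move=> Cc Cs; have [_ [_ Cirr] _] := Cc.
  have [|||Cl|Cl] := Cirr (boundary chi l1) (boundary chi l2).
  - exact: boundary_closed.
  - exact: boundary_closed.
  - by move=> x /Cs/sing_sub.
  - by left; apply: irreducible_curve_boundary lP Cc Cl.
  - by right; apply: irreducible_curve_boundary (separating_gradingsC lP) Cc Cl.
suff -> : singular_locus k S = boundary chi l1 `|` boundary chi l2.
  by move=> x; split=> [/torusE|/torusE].
have [] := curve C1 C1c; first by rewrite singE => x; left.
  have [] := curve C2 C2c; first by rewrite singE => x; right.
    by move=> C2E C1E; case: C12; rewrite C1E C2E.
  by move=> C2E C1E; rewrite singE C1E C2E.
have [] := curve C2 C2c; first by rewrite singE => x; right.
  by move=> C2E C1E; rewrite singE C1E C2E setUC.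
by move=> C2E C1E; case: C12; rewrite C1E C2E.
Qed.

End SingularLocus.

Section ToricSurface.
Variables (k : closedFieldType) (S : affine_monoid 2) (d e : nat).
Hypotheses (d_ge2 : (2 <= d)%N).
Hypothesis rays : [set m | ray_generator (dual_cone (sigma S)) m] =
                  [set vec2 0 1; vec2 d%:Z (- e%:Z)].
Hypothesis normalization : normalization_monoid S = Xde_monoid d e.
Local Notation E := (am_elt S).
Local Notation chi := (@char k 2 S).

Let d0 : d%:Z != 0. Proof. by rewrite eqz_nat -lt0n ltnW. Qed.

Lemma form2_ge0 m : m \in S -> 0 <= form2 1 0 m /\ 0 <= form2 e%:Z d%:Z m.
Proof.
move=> mS; have : normalization_monoid S m by move=> u; apply.
by rewrite normalization /form2 mul1r mul0r addr0.
Qed.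

(** [deg1] vanishes on the ray of [(0,1)] and [deg2] on that of [(d,-e)]; [absz] loses nothing, as
    both forms are nonnegative on [S]. *)
Definition deg1 (m : E) : nat := absz (form2 1 0 (am_val m)).
Definition deg2 (m : E) : nat := absz (form2 e%:Z d%:Z (am_val m)).

Lemma deg1E m : deg1 m = form2 1 0 (am_val m) :> int.
Proof. by apply: gez0_abs; have [] := form2_ge0 (am_elt_mem m). Qed.

Lemma deg2E m : deg2 m = form2 e%:Z d%:Z (am_val m) :> int.
Proof. by apply: gez0_abs; have [] := form2_ge0 (am_elt_mem m). Qed.

Lemma deg_separating : separating_gradings deg1 deg2.
Proof.
split.
- by rewrite /deg1 am_val0 form2_0.
- by rewrite /deg2 am_val0 form2_0.
- move=> m p; apply/eqP; rewrite -eqz_nat PoszD !deg1E am_valD form2D.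
  exact: eqxx.
- move=> m p; apply/eqP; rewrite -eqz_nat PoszD !deg2E am_valD form2D.
  exact: eqxx.
move=> m p /(congr1 Posz); rewrite !deg1E /form2 !mul1r !mul0r !addr0 => mp0.
move=> /(congr1 Posz); rewrite !deg2E /form2 mp0 => /addrI/(mulfI d0) mp1.
exact/am_val_inj/col2P.
Qed.

Hypothesis sing : exists C1 C2 : set (cpoint k S),
  [/\ irreducible_curve C1, irreducible_curve C2, C1 <> C2 &
      singular_locus k S = C1 `|` C2].

Lemma surface_singular_locus (x : cpoint k S) :
  singular_locus k S x <-> ~ torus_pt chi x.
Proof.
have d_gt0 : 0 < d%:Z by rewrite ltz_nat ltnW.
(* The ray vectors may be missing from [S], but each ray carries some nonzero element of it. *)
have [||||e1 [e11 e12]] := @face_elt S 1 0 e%:Z d%:Z (vec2 0 1).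
- by move=> m /form2_ge0[].
- by rewrite normalization; split; rewrite !mxE //= mulr0 mulr1 add0r ltW.
- by rewrite /form2 !mxE /= mul1r mul0r.
- by rewrite /form2 !mxE /= mulr0 mulr1 add0r.
have [||||e2 [e21 e22]] := @face_elt S e%:Z d%:Z 1 0 (vec2 d%:Z (- e%:Z)).
- by move=> m /form2_ge0[].
- rewrite normalization; split; rewrite !mxE //=.
  by rewrite mulrN mulrC subrr.
- by rewrite /form2 !mxE /= mulrN mulrC subrr.
- by rewrite /form2 !mxE /= mul1r mul0r addr0.
apply: (singular_locus_torus deg_separating (e1 := e1) (e2 := e2)) => //.
- by rewrite /deg1 e11.
- by rewrite -ltz_nat deg2E.
- by rewrite -ltz_nat deg1E.
- by rewrite /deg2 e21.
Qed.

(** [A] permutes the two ray generators, and their images determine its entries. For the exchange,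
    the lower left entry times [d] is [1 - e^2], which forces the congruence. *)
Lemma cone_automorphism (A B : 'M[int]_2) :
    A *m B = 1%:M -> B *m A = 1%:M ->
    (forall m, m \in S -> A *m m \in S) ->
    (forall m, m \in S -> B *m m \in S) ->
  A = 1%:M \/ (e ^ 2 = 1 %[mod d])%N /\ A = swap_mx d e.
Proof.
move=> AB BA AS BS.
have ray m : ray_generator (dual_cone (sigma S)) m <->
    m = vec2 0 1 \/ m = vec2 d%:Z (- e%:Z).
  by have := congr1 (fun X => X m) rays => /= ->.
have Aray m : m = vec2 0 1 \/ m = vec2 d%:Z (- e%:Z) ->
    A *m m = vec2 0 1 \/ A *m m = vec2 d%:Z (- e%:Z).
  by move=> /ray mr; apply/ray; apply: ray_generator_stable AB BA AS BS mr.
have u12 : vec2 0 1 <> vec2 d%:Z (- e%:Z).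
  by move=> /colP/(_ 0); rewrite !mxE /= => /esym/eqP; apply/negP.
have Ainj m m' : A *m m = A *m m' -> m = m'.
  by move=> /(congr1 (mulmx B)); rewrite !mulmxA BA !mul1mx.
have AE (a b c f : int) : A *m vec2 0 1 = vec2 a b ->
    A *m vec2 d%:Z (- e%:Z) = vec2 c f ->
    [/\ A 0 1 = a, A 1 1 = b, A 0 0 * d%:Z = c + a * e%:Z &
        A 1 0 * d%:Z = f + b * e%:Z].
  move=> /colP A1 /colP A2.
  have := A1 0; have := A1 1; rewrite !mulmx2E !mxE /= !mulr0 !add0r !mulr1.
  move=> -> ->; have := A2 0; have := A2 1; rewrite !mulmx2E !mxE /=.
  have := A1 0; have := A1 1; rewrite !mulmx2E !mxE /= !mulr0 !add0r !mulr1.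
  by move=> -> -> <- <-; rewrite !mulrN !subrK.
have mat2P (M N : 'M[int]_2) : M 0 0 = N 0 0 -> M 0 1 = N 0 1 ->
    M 1 0 = N 1 0 -> M 1 1 = N 1 1 -> M = N.
  move=> M00 M01 M10 M11; apply/matrixP => i j.
  have E2 (l : 'I_2) : l = 0 \/ l = 1.
    by case: l => [[|[|l]] l2] //; [left | right]; apply/val_inj.
  by have [->|->] := E2 i; have [->|->] := E2 j.
have [A1|A1] := Aray _ (or_introl erefl).
  have [A2|A2] := Aray _ (or_intror erefl).
    by case: u12; apply: Ainj; rewrite A1 A2.
  left; have [a01 a11 a00 a10] := AE _ _ _ _ A1 A2.
  apply: mat2P; rewrite ?a01 ?a11 ?mxE //.
    by apply: (mulIf d0); rewrite a00 mul0r addr0 mul1r.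
  by apply: (mulIf d0); rewrite a10 mul1r addNr mul0r.
have [A2|A2] := Aray _ (or_intror erefl); last first.
  by case: u12; apply: Ainj; rewrite A1 A2.
right; have [a01 a11 a00 a10] := AE _ _ _ _ A1 A2.
have de : (e ^ 2 = 1 %[mod d])%N.
  apply/eqP; rewrite -eqz_nat -!modz_nat eqz_mod_dvd.
  apply/dvdzP; exists (- A 1 0).
  rewrite mulNr a10 mulNr opprD opprK addrC.
  by rewrite -mulnn PoszM.
split=> //; apply: mat2P; rewrite ?a01 ?a11 !mxE //=.
  by apply: (mulIf d0); rewrite a00 add0r mulrC.
by apply: (mulIf d0); rewrite a10 swap_coefE // mulNr expr2.
Qed.

End ToricSurface.

(** * Toric surfaces *)

Section TorusCharacters.
Variable k : fieldType.
Implicit Types (t s : torus2 k) (m p : 'cV[int]_2).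

Definition tchar t m : k := (gm_val t.1) ^ m 0 0 * (gm_val t.2) ^ m 1 0.

Lemma tchar_neq0 t m : tchar t m != 0.
Proof. by rewrite mulf_neq0 // expfz_neq0 // gm_neq0. Qed.

Lemma tchar0 t : tchar t 0 = 1.
Proof. by rewrite /tchar !mxE !expr0z mulr1. Qed.

Lemma tcharD t m p : tchar t (m + p) = tchar t m * tchar t p.
Proof. by rewrite /tchar !mxE !expfzDr ?gm_neq0 // mulrACA. Qed.

Lemma tchar1 m : tchar 1%g m = 1.
Proof. by rewrite /tchar /= !exp1rz mulr1. Qed.

Lemma tcharM t s m : tchar (t * s)%g m = tchar t m * tchar s m.
Proof. by rewrite /tchar /= !expfzMl mulrACA. Qed.

(** The exponents in the two components of [torus_tau] are the columns of [swap_mx], so the map on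
    the torus is dual to the matrix on characters. *)
Lemma tchar_tau d e t m :
  tchar (torus_tau d e t) m = tchar t (swap_mx d e *m m).
Proof.
rewrite /tchar !mulmx2E !mxE /= !expfzMl !exprz_exp mulrACA.
by rewrite -!expfzDr ?gm_neq0.
Qed.

Lemma tchar_inj (S : affine_monoid 2) t s :
  (forall m : am_elt S, tchar t (am_val m) = tchar s (am_val m)) -> t = s.
Proof.
move=> ts; have [p [q pqE]] := am_basis S.
have tsi i : tchar t (delta_mx i 0) = tchar s (delta_mx i 0).
  apply: (mulfI (tchar_neq0 t (am_val (q i)))).
  rewrite -tcharD [in RHS]ts -tcharD -pqE addrCA subrr addr0.
  exact: ts.
case: t s ts tsi => [t1 t2] [s1 s2] _ tsi; congr pair; apply/val_inj.
  by have := tsi 0; rewrite /tchar !mxE /= !expr1z !expr0z !mulr1.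
by have := tsi 1; rewrite /tchar !mxE /= !expr1z !expr0z !mul1r.
Qed.

End TorusCharacters.

(** * The automorphism group of the surface *)

Section Main.
Variables (k : closedFieldType) (S : affine_monoid 2) (d e : nat).
Hypotheses (d_ge2 : (2 <= d)%N).
Hypothesis rays : [set m | ray_generator (dual_cone (sigma S)) m] =
                  [set vec2 0 1; vec2 d%:Z (- e%:Z)].
Hypothesis normalization : normalization_monoid S = Xde_monoid d e.
Hypothesis sing : exists C1 C2 : set (cpoint k S),
  [/\ irreducible_curve C1, irreducible_curve C2, C1 <> C2 &
      singular_locus k S = C1 `|` C2].
Local Notation E := (am_elt S).
Local Notation chi := (@char k 2 S).

Lemma aut_normal_form (phi : toric_aut k S) :
  exists (t : torus2 k) (A : 'M[int]_2) (alpha : E -> E),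
    [/\ A = 1%:M \/ ((e ^ 2 = 1 %[mod d])%N /\ preserves (swap_mx d e) S) /\
                     A = swap_mx d e,
        forall m, am_val (alpha m) = A *m am_val m &
        forall x m, phi x (chi m) = tchar t (am_val m) * x (chi (alpha m))].
Proof.
have [c [alpha [beta [c0 [c1 cD] [aD bD] [aK bK] phiE]]]] :=
  aut_monomial (deg_separating d_ge2 normalization)
    (surface_singular_locus d_ge2 normalization sing) phi.
have [A AE] := am_matrix aD; have [B BE] := am_matrix bD.
have AB : A *m B = 1%:M.
  by apply: (@am_matrix_eq _ S) => m; rewrite -mulmxA -BE -AE bK mul1mx.
have BA : B *m A = 1%:M.
  by apply: (@am_matrix_eq _ S) => m; rewrite -mulmxA -AE -BE aK mul1mx.
have AS m : m \in S -> A *m m \in S.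
  by move=> /am_eltP[m' <-]; rewrite -AE; apply: am_elt_mem.
have BS m : m \in S -> B *m m \in S.
  by move=> /am_eltP[m' <-]; rewrite -BE; apply: am_elt_mem.
have [p [q pqE]] := am_basis S.
have cE := multiplicative_monomial (@am_val_inj _ S) (am_val0 S) (@am_valD _ S)
  pqE c0 c1 cD.
have r0 i : c (p i) / c (q i) != 0 by rewrite mulf_neq0 ?invr_eq0 ?c0.
exists (MkGm (r0 0), MkGm (r0 1)), A, alpha; split=> //.
  have [|[de Asw]] := cone_automorphism d_ge2 rays AB BA AS BS; first by left.
  right; split=> //; split=> //; rewrite -Asw; apply/seteqP; split=> m /=.
    by move=> [m' /AS m'S <-].
  by move=> mS; exists (B *m m); [apply: BS | rewrite mulmxA AB mul1mx].
move=> x m; rewrite phiE cE !big_ord_recl big_ord0 mulr1.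
by rewrite (_ : lift ord0 ord0 = 1) //; apply/val_inj.
Qed.

Lemma aut_torus_iso : ~ ((e ^ 2 = 1 %[mod d])%N /\ preserves (swap_mx d e) S) ->
  group_iso (toric_aut k S) (torus2 k).
Proof.
move=> noswap.
apply: (aut_group_iso (deg_separating d_ge2 normalization)
  (c := fun t m => tchar t (am_val m)) (alpha := fun _ m => m)).
- by move=> t m; apply: tchar_neq0.
- by move=> t; rewrite am_val0 tchar0.
- by move=> t m p; rewrite am_valD tcharD.
- by [].
- by [].
- by move=> m; apply: tchar1.
- by [].
- by move=> t s m; apply: tcharM.
- by [].
- by move=> t s /tchar_inj.
move=> phi; have [t [A [alpha [[A1|[]//] aE phiE]]]] := aut_normal_form phi.
exists t => x m; rewrite phiE; congr (_ * x (chi _)).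
by apply: am_val_inj; rewrite aE A1 mul1mx.
Qed.

Lemma aut_swap_iso (de : (e ^ 2 = 1 %[mod d])%N) : preserves (swap_mx d e) S ->
  group_iso (toric_aut k S) (semidirect (torus_action k de)).
Proof.
move=> pS; set T := swap_mx d e in pS.
have /choice[sw swE] : forall m : E, exists m' : E, am_val m' = T *m am_val m.
  move=> m; apply: am_eltP.
  suff : [set` S] (T *m am_val m) by [].
  by rewrite -pS; exists (am_val m) => //; apply: am_elt_mem.
have TT : T *m T = 1%:M.
  have cde := swap_coefE de; apply/matrixP => i j.
  rewrite mxE !big_ord_recl big_ord0 !mxE /= addr0.
  case: i j => [[|[|i]] i2] [[|[|j]] j2] //=.
  - by rewrite [d%:Z * _]mulrC cde; ring.
  - by ring.
  - by ring.
  - by rewrite cde; ring.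
have swK m : sw (sw m) = m.
  by apply: am_val_inj; rewrite !swE mulmxA TT mul1mx.
have swD m p : sw (m + p) = sw m + sw p.
  by apply: am_val_inj; rewrite swE !am_valD !swE mulmxDr.
have sw0 : sw 0 = 0 by apply: am_val_inj; rewrite swE am_val0 mulmx0.
(* The action on the torus is adjoint to the one on exponents; this turns the semidirect product law
   into the cocycle rule. *)
have tchar_iter i t (m : E) :
    tchar (iter i (@torus_tau k d e) t) (am_val m) =
    tchar t (am_val (iter i sw m)).
  by elim: i m => // i IHi m; rewrite iterS tchar_tau -swE IHi -iterSr.
apply: (aut_group_iso (deg_separating d_ge2 normalization)
  (H := semidirect (torus_action k de))
  (c := fun g m => tchar (sd_snd g) (am_val m))
  (alpha := fun g => iter (sd_fst g) sw)).
- by move=> g m; apply: tchar_neq0.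
- by move=> g; rewrite am_val0 tchar0.
- by move=> g m p; rewrite am_valD tcharD.
- by move=> g; elim: (sd_fst g : nat) => //= i ->.
- by move=> g m p; elim: (sd_fst g : nat) => //= i ->.
- by move=> m; apply: tchar1.
- by [].
- by move=> g h m; rewrite tcharM tchar_iter.
(* The reversed order of composition is harmless: all maps here are powers of one involution. *)
- move=> [a t] [b s] m /=.
  by case: a b => [[|[|a]] // a2] [[|[|b]] // b2] /=; rewrite ?swK.
- move=> [a t] [b s] /= /tchar_inj -> ab; congr SDProd.
  (* The upper right entry [d] of [T] is nonzero, so the map on exponents detects the component in
     ['Z_2]. *)
  have sw_id : ~ sw =1 id.
    move=> sw1; have T1 : T = 1%:M.
      by apply: (@am_matrix_eq _ S) => m; rewrite -swE sw1 mul1mx.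
    have /matrixP/(_ 0 1) := T1; rewrite !mxE /= => d0.
    by move: d_ge2; rewrite -ltz_nat d0.
  apply/val_inj; move: ab.
  case: a b => [[|[|a]] // a2] [[|[|b]] // b2] /= ab; case: sw_id => m;
    first [exact: ab | exact/esym/ab].
move=> phi; have [t [A [alpha [AE aE phiE]]]] := aut_normal_form phi.
case: AE => [A1|[_ AT]].
  exists (SDProd (torus_action k de) (0 : 'Z_2) t) => x m.
  rewrite phiE; congr (_ * x (chi _)).
  by apply: am_val_inj; rewrite aE A1 mul1mx.
exists (SDProd (torus_action k de) (Ordinal (isT : (1 < 2)%N) : 'Z_2) t) => x m.
rewrite phiE; congr (_ * x (chi _)).
by apply: am_val_inj; rewrite aE AT -swE.
Qed.

End Main.

Theorem proposition2 (k : closedFieldType) (chark : [pchar k] =i pred0)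
    (S : affine_monoid 2) (d e : nat)
    (d_ge2 : (2 <= d)%N) (e_gt0 : (0 < e)%N) (e_lt_d : (e < d)%N)
    (co_de : coprime d e)
    (rays : [set m | ray_generator (dual_cone (sigma S)) m] =
            [set vec2 0 1; vec2 d%:Z (- e%:Z)])
    (normalization : normalization_monoid S = Xde_monoid d e)
    (sing : exists C1 C2 : set (cpoint k S),
      [/\ irreducible_curve C1, irreducible_curve C2, C1 <> C2 &
          singular_locus k S = C1 `|` C2]) :
  (forall de : (e ^ 2 = 1 %[mod d])%N,
    preserves (swap_mx d e) S ->
    group_iso (toric_aut k S) (semidirect (torus_action k de))) /\
  (~ ((e ^ 2 = 1 %[mod d])%N /\ preserves (swap_mx d e) S) ->
    group_iso (toric_aut k S) (torus2 k)).
Proof.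
split; last exact: aut_torus_iso d_ge2 rays normalization sing.
exact: aut_swap_iso d_ge2 rays normalization sing.
Qed.
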